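(* If $(C,\langle\cdot,\cdot\rangle,\{\mathfrak m^t_{k,\beta}\},\{\mathfrak c^t_{k,\beta}\})$ is a pseudo-isotopy of $G$-gapped cyclic filtered $A_\infty$ algebras, then there exists a filtered $A_\infty$ homomorphism from $(C,\langle\cdot,\cdot\rangle,\{\mathfrak m^0_{k,\beta}\})$ to $(C,\langle\cdot,\cdot\rangle,\{\mathfrak m^1_{k,\beta}\})$ (the structures at $t=0$ and $t=1$) which is cyclic and has an inverse. The modulo $T^E$ and/or unital versions also hold (i.e. for a pseudo-isotopy modulo $T^E$ one obtains such a homomorphism modulo $T^E$, and for a unital pseudo-isotopy the homomorphism can be taken unital).
   Context: $G\subset\mathbb R_{\ge0}\times2\mathbb Z$, with projections $E:G\to\mathbb R$, $\mu:G\to2\mathbb Z$, is a discrete submonoid: $(0,0)\in G$, $G$ is closed under addition, $E(G)$ is discrete, $G\cap E^{-1}(\lambda)$ is finite for each $\lambda$. For a graded real vector space $\overline C$ put $\deg'x=\deg x-1$; $\overline C[1]$ is $\overline C$ graded by $\deg'$; $B_k$ is the $k$-fold tensor power. A $G$-gapped cyclic filtered $A_\infty$ algebra consists of a nondegenerate bilinear pairing $\langle\cdot,\cdot\rangle:\overline C^j\otimes\overline C^{n-j}\to\mathbb R$ ($n$ fixed) with $\langle x,y\rangle=(-1)^{1+\deg'x\deg'y}\langle y,x\rangle$ and linear maps $\mathfrak m_{k,\beta}:B_k(\overline C[1])\to\overline C[1]$ of degree $1-\mu(\beta)$, $k\ge0$, $\beta\in G$, such that (i) $\mathfrak m_{0,(0,0)}=0$;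 (ii) $\sum_{k_1+k_2=k+1}\sum_{\beta_1+\beta_2=\beta}\sum_{i=1}^{k-k_2+1}(-1)^{\deg'x_1+\cdots+\deg'x_{i-1}}\mathfrak m_{k_1,\beta_1}(x_1,\ldots,\mathfrak m_{k_2,\beta_2}(x_i,\ldots,x_{i+k_2-1}),\ldots,x_k)=0$; (iii) $\langle\mathfrak m_{k,\beta}(x_1,\ldots,x_k),x_0\rangle=(-1)^{\deg'x_0(\deg'x_1+\cdots+\deg'x_k)}\langle\mathfrak m_{k,\beta}(x_0,x_1,\ldots,x_{k-1}),x_k\rangle$; (iv) the pairing induced on the $\mathfrak m_{1,(0,0)}$-cohomology is perfect. A unit is $\mathbf e\in\overline C^0$ with $\mathfrak m_{2,(0,0)}(\mathbf e,x)=(-1)^{\deg x}\mathfrak m_{2,(0,0)}(x,\mathbf e)=x$ and $\mathfrak m_{k,\beta}(\ldots,\mathbf e,\ldots)=0$ for $(k,\beta)\ne(2,(0,0))$. ''Modulo $T^{E}$'' always means that operations are given and relations required only for $E(\beta)<E$. $C^\infty([0,1],\overline C)$ is the set of finite sums $\sum a_i(t)\mathfrak e_i$ with $a_i\in C^\infty([0,1])$ and $\mathfrak e_i$ in a basis of $\overline C$. A pseudo-isotopy consists of maps $\mathfrak m^t_{k,\beta},\mathfrak c^t_{k,\beta}:B_k(\overline C[1])\to\overline C[1]$, $t\in[0,1]$, of degree $1-\mu(\beta)$ and $-\mu(\beta)$, such that: (1) $t\mapsto\mathfrak m^t_{k,\beta}(x_1,\ldots,x_k)$ and $t\mapsto\mathfrak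 c^t_{k,\beta}(x_1,\ldots,x_k)$ are in $C^\infty([0,1],\overline C)$; (2) for each $t$, $(\overline C,\langle\cdot,\cdot\rangle,\{\mathfrak m^t_{k,\beta}\})$ is a $G$-gapped cyclic filtered $A_\infty$ algebra; (3) $\langle\mathfrak c^t_{k,\beta}(x_1,\ldots,x_k),x_0\rangle=(-1)^{\deg'x_0(\deg'x_1+\cdots+\deg'x_k)}\langle\mathfrak c^t_{k,\beta}(x_0,\ldots,x_{k-1}),x_k\rangle$; (4) with sums over $k_1+k_2=k+1$, $\beta_1+\beta_2=\beta$, $1\le i\le k-k_2+1$, $\frac{d}{dt}\mathfrak m^t_{k,\beta}(x_1,\ldots,x_k)+\sum(-1)^{\deg'x_1+\cdots+\deg'x_{i-1}}\mathfrak c^t_{k_1,\beta_1}(x_1,\ldots,\mathfrak m^t_{k_2,\beta_2}(x_i,\ldots),\ldots,x_k)-\sum\mathfrak m^t_{k_1,\beta_1}(x_1,\ldots,\mathfrak c^t_{k_2,\beta_2}(x_i,\ldots),\ldots,x_k)=0$; (5) $\mathfrak m^t_{k,(0,0)}$ is independent of $t$ and $\mathfrak c^t_{k,(0,0)}=0$. It is unital with unit $\mathbf e$ if $\mathbf e$ is a unit of $\{\mathfrak m^t_{k,\beta}\}$ for each $t$ and $\mathfrak c^t_{k,\beta}(\ldots,\mathbf e,\ldots)=0$. A ($G$-gapped) filtered $A_\infty$ homomorphism $\mathfrak f=\{\mathfrak f_{k,\beta}\}:C\to C'$ consists of linear maps $\mathfrak f_{k,\beta}:B_k(\overline C[1])\to\overline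 C'[1]$ of degree $-\mu(\beta)$ with $\mathfrak f_{0,(0,0)}=0$ and, for all $k,\beta$, $$\sum\mathfrak m'_{\ell,\beta_0}(\mathfrak f_{k_1,\beta_1}(x_1,\ldots),\ldots,\mathfrak f_{k_\ell,\beta_\ell}(\ldots,x_k))=\sum(-1)^{\deg'x_1+\cdots+\deg'x_{i-1}}\mathfrak f_{k_1,\beta_1}(x_1,\ldots,\mathfrak m_{k_2,\beta_2}(x_i,\ldots),\ldots,x_k),$$ where on the left $\beta_0+\cdots+\beta_\ell=\beta$, $k_1+\cdots+k_\ell=k$ and on the right $k_1+k_2=k+1$, $\beta_1+\beta_2=\beta$, $1\le i\le k-k_2+1$. It is cyclic if $\langle\mathfrak f_{1,(0,0)}(x),\mathfrak f_{1,(0,0)}(y)\rangle=\langle x,y\rangle$ and $\sum_{\beta_1+\beta_2=\beta}\sum_{k_1+k_2=k}\langle\mathfrak f_{k_1,\beta_1}(x_1,\ldots,x_{k_1}),\mathfrak f_{k_2,\beta_2}(x_{k_1+1},\ldots,x_k)\rangle=0$ for $(k,\beta)\ne(2,(0,0))$ ($k_1,k_2\ge0$). It is unital if $\mathfrak f_{1,(0,0)}(\mathbf e)=\mathbf e$, $\mathfrak f_{1,\beta}(\mathbf e)=0$ for $\beta\ne(0,0)$, and $\mathfrak f_{k,\beta}(\ldots,\mathbf e,\ldots)=0$ for $k>1$. The composition is $(\mathfrak g\circ\mathfrak f)_{k,\beta}=\sum\mathfrak g_{\ell,\beta_0}(\mathfrak f_{k_1,\beta_1}\otimes\cdots\otimes\mathfrak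 f_{k_\ell,\beta_\ell})$; the identity has only the component $(1,(0,0))$, equal to the identity map. An inverse is a filtered $A_\infty$ homomorphism whose compositions with $\mathfrak f$ on both sides are identities. *)

(* Defs.v *)
From HB Require Import structures.
From mathcomp Require Import all_boot all_order all_algebra.
From mathcomp Require Import all_classical all_reals all_analysis.

Set Implicit Arguments.
Unset Strict Implicit.
Unset Printing Implicit Defensive.

Import Order.TTheory GRing.Theory Num.Theory.
Import numFieldNormedType.Exports.

Local Open Scope classical_set_scope.
Local Open Scope ring_scope.

(* An element of G is a pair b with b.1 = E(b) and b.2 = mu(b).  Discreteness
   of E(G) is that of the subspace E(G) of the line (all points isolated);
   E(G) is not assumed closed. *)
Record gapping_monoid (R : realType) (G : set (R * int)) : Prop := {
  gapping_energy : forall b, G b -> 0 <= b.1;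
  gapping_even : forall b, G b -> (2 %| b.2)%Z;
  gapping0 : G (0, 0);
  gappingD : forall b b', G b -> G b' -> G (b + b');
  gapping_discrete : forall l, (fst @` G) l -> isolated (fst @` G) l;
  gapping_finite : forall l, finite_set [set b | G b /\ b.1 = l] }.

(* The part of G seen modulo T^E; there is no truncation when E = +oo. *)
Definition below (R : realType) (G : set (R * int)) (E : \bar R) :
    set (R * int) :=
  [set b | G b /\ (b.1%:E < E)%E].

(* V is the internal direct sum of the subspaces C j, j in Z. *)
Record grading (R : realType) (V : lmodType R) (C : int -> set V) : Prop := {
  grading0 : forall j, C j 0;
  gradingP : forall j (a : R) u v, C j u -> C j v -> C j (a *: u + v);
  grading_sum : forall v, exists! u : int -> V,
    [/\ forall j, C j (u j), finite_set [set j | u j != 0]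
      & v = \sum_(j \in [set: int]) u j] }.

(* x is a sequence of homogeneous vectors, of (unshifted) degrees d. *)
Definition homogeneous (R : realType) (V : lmodType R) (C : int -> set V)
    (d : seq int) (x : seq V) : Prop :=
  size d = size x /\ forall i, (i < size x)%N -> C (nth 0 d i) (nth 0 x i).

(* deg' x_1 + ... + deg' x_k, where deg' = deg - 1. *)
Definition sdeg (d : seq int) : int := \sum_(j <- d) (j - 1).

(* A family of maps indexed by (k, b): the value of the (k, b) component at
   x_1, ..., x_k is [f b [:: x_1; ...; x_k]].  Values at b outside G (or
   outside [below G E]) are irrelevant. *)
Definition operations (R : realType) (V : lmodType R) := R * int -> seq V -> V.

(* On each seq of fixed length k, a k-multilinear map, i.e. a linear map on
   the k-fold tensor power. *)
Definition multilinear (R : realType) (V : lmodType R) (f : seq V -> V) :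
    Prop :=
  forall s1 s2 : seq V, linear (fun x => f (s1 ++ x :: s2)).

(* Degree r with respect to deg'; the summand 1 converts deg' back to deg. *)
Definition has_degree (R : realType) (V : lmodType R) (C : int -> set V)
    (f : seq V -> V) (r : int) : Prop :=
  forall d x, homogeneous C d x -> C (sdeg d + r + 1) (f x).

(* Linear maps of degree r b - mu(b) for the relevant b. *)
Record graded_operations (R : realType) (V : lmodType R) (C : int -> set V)
    (G : set (R * int)) (E : \bar R) (r : int) (f : operations V) : Prop := {
  op_multilinear : forall b, below G E b -> multilinear (f b);
  op_degree : forall b, below G E b -> has_degree C (f b) (r - b.2) }.

(* Pairs (b1, b2) with b1 + b2 = b. *)
Definition splittings (R : realType) (G : set (R * int)) (b : R * int) :
    set ((R * int) * (R * int)) :=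
  [set p | [/\ G p.1, G p.2 & p.1 + p.2 = b]].

(* The sum over k1 + k2 = k + 1, b1 + b2 = b and 1 <= i + 1 <= k - k2 + 1 of
     (-1)^(eps (deg' x_1 + ... + deg' x_i))
       p_{k1,b1}(x_1, ..., q_{k2,b2}(x_{i+1}, ..., x_{i+k2}), ..., x_k),
   for x of degrees d: eps = 1 gives the signed sums and eps = 0 the unsigned
   ones. *)
Definition insertions (R : realType) (V : lmodType R) (G : set (R * int))
    (eps : int) (p q : operations V) (b : R * int) (d : seq int)
    (x : seq V) : V :=
  \sum_(k2 < (size x).+1) \sum_(i < (size x - k2).+1)
    \sum_(c \in splittings G b)
      ((-1) ^ (eps * sdeg (take i d)))
        *: p c.1 (take i x ++ q c.2 (take k2 (drop i x)) :: drop (i + k2) x).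

(* <f(x_1, ..., x_k), x_0>
     = (-1)^(deg' x_0 (deg' x_1 + ... + deg' x_k)) <f(x_0, ..., x_{k-1}), x_k>;
   [belast x0 x] is x_0, ..., x_{k-1}. *)
Definition cyclically_symmetric (R : realType) (V : lmodType R)
    (C : int -> set V) (pair : V -> V -> R) (f : seq V -> V) : Prop :=
  forall d0 x0 d x, C d0 x0 -> homogeneous C d x ->
    pair (f x) x0 =
    (-1) ^ ((d0 - 1) * sdeg d) * pair (f (belast x0 x)) (last x0 x).

(* The pairing is given on C^j x C^(n-j); on the total space it is extended by
   zero on C^i x C^j with i + j <> n. *)
Record graded_pairing (R : realType) (V : lmodType R) (C : int -> set V)
    (n : int) (pair : V -> V -> R) : Prop := {
  pair_linearl : forall y, scalar (fun x => pair x y);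
  pair_linearr : forall x, scalar (fun y => pair x y);
  pair_degree : forall i j x y, C i x -> C j y -> i + j != n -> pair x y = 0;
  pair_sign : forall i j x y, C i x -> C j y ->
    pair x y = (-1) ^ (1 + (i - 1) * (j - 1)) * pair y x;
  pair_nondegenerate : forall j x, C j x ->
    (forall y, C (n - j) y -> pair x y = 0) -> x = 0 }.

Definition cocycles (R : realType) (V : lmodType R) (C : int -> set V)
    (D : V -> V) (j : int) : set V :=
  [set z | C j z /\ D z = 0].

Definition coboundaries (R : realType) (V : lmodType R) (C : int -> set V)
    (D : V -> V) (j : int) : set V :=
  D @` C (j - 1).

(* The map from H^j to the linear dual of H^(n-j) is bijective for all j, where
   H^j = cocycles j / coboundaries j.  A linear form on H^(n-j) is a linear
   form on cocycles (n-j) which vanishes on coboundaries (n-j).  By [pair_sign]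
   the other adjoint maps are the same up to sign, with j and n-j exchanged. *)
Definition perfect_on_cohomology (R : realType) (V : lmodType R)
    (C : int -> set V) (n : int) (pair : V -> V -> R) (D : V -> V) : Prop :=
  forall j,
    (forall z, cocycles C D j z ->
       (forall w, cocycles C D (n - j) w -> pair z w = 0) ->
       coboundaries C D j z) /\
    (forall phi : V -> R,
       (forall a u v, cocycles C D (n - j) u -> cocycles C D (n - j) v ->
          phi (a *: u + v) = a * phi u + phi v) ->
       (forall u, coboundaries C D (n - j) u -> phi u = 0) ->
       exists2 z, cocycles C D j z &
         forall w, cocycles C D (n - j) w -> pair z w = phi w).

(* G-gapped cyclic filtered A-infinity algebra, modulo T^E. *)
Record cyclic_Ainfty (R : realType) (V : lmodType R) (C : int -> set V)
    (n : int) (pair : V -> V -> R) (G : set (R * int)) (E : \bar R)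
    (m : operations V) : Prop := {
  ainf_pairing : graded_pairing C n pair;
  ainf_graded : graded_operations C G E 1 m;
  ainf_m00 : m (0, 0) [::] = 0;
  ainf_relation : forall b d x, below G E b -> homogeneous C d x ->
    insertions G 1 m m b d x = 0;
  ainf_cyclic : forall b, below G E b -> cyclically_symmetric C pair (m b);
  ainf_perfect :
    perfect_on_cohomology C n pair (fun v => m (0, 0) [:: v]) }.

Record is_unit (R : realType) (V : lmodType R) (C : int -> set V)
    (G : set (R * int)) (E : \bar R) (e : V) (m : operations V) : Prop := {
  unit_degree : C 0 e;
  unit_left : forall x, m (0, 0) [:: e; x] = x;
  unit_right : forall j x, C j x -> (-1) ^ j *: m (0, 0) [:: x; e] = x;
  unit_vanish : forall b s1 s2, below G E b ->
    ((size (s1 ++ e :: s2), b) != (2%N, (0, 0))) -> m b (s1 ++ e :: s2) = 0 }.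

(* B is a (Hamel) basis of V. *)
Definition is_basis (R : realType) (V : lmodType R) (B : set V) : Prop :=
  forall v, exists! a : V -> R,
    [/\ [set e | a e != 0] `<=` B, finite_set [set e | a e != 0]
      & v = \sum_(e \in B) a e *: e].

(* l is the derivative at t of the function a on [0,1] (one-sided if t is an
   endpoint). *)
Definition derivative01 (R : realType) (a : R -> R) (t l : R) : Prop :=
  (a s - a t) / (s - t) @[s --> within `[0, 1] t^'] --> l.

(* D k is the k-th derivative of a on [0,1]. *)
Definition smooth01 (R : realType) (a : R -> R) : Prop :=
  exists D : nat -> R -> R,
    {in `[0, 1], D 0%N =1 a} /\
    forall k t, t \in `[0, 1] -> derivative01 (D k) t (D k.+1 t).

(* phi(t) is the finite sum of the a_e(t) e, e ranging over the elements of s,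
   which belong to a basis of V. *)
Definition expansion01 (R : realType) (V : lmodType R) (phi : R -> V)
    (s : seq V) (a : V -> R -> R) : Prop :=
  [/\ exists2 B, is_basis B & [set e | e \in s] `<=` B, uniq s
    & forall t, t \in `[0, 1] -> phi t = \sum_(e <- s) a e t *: e].

(* C^infty([0,1], V). *)
Definition smooth_curve (R : realType) (V : lmodType R) (phi : R -> V) : Prop :=
  exists s a, expansion01 phi s a /\ forall e, e \in s -> smooth01 (a e).

(* v is the derivative of phi at t, taken coefficientwise; v is unique. *)
Definition curve_derivative (R : realType) (V : lmodType R) (phi : R -> V)
    (t : R) (v : V) : Prop :=
  exists s a (l : V -> R),
    [/\ expansion01 phi s a,
        forall e, e \in s -> derivative01 (a e) t (l e)
      & v = \sum_(e <- s) l e *: e].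

(* Pseudo-isotopy, modulo T^E; only t in [0,1] matters. *)
Record pseudo_isotopy (R : realType) (V : lmodType R) (C : int -> set V)
    (n : int) (pair : V -> V -> R) (G : set (R * int)) (E : \bar R)
    (m c : R -> operations V) : Prop := {
  iso_smooth_m : forall b x, below G E b -> smooth_curve (fun t => m t b x);
  iso_smooth_c : forall b x, below G E b -> smooth_curve (fun t => c t b x);
  iso_ainf : forall t, t \in `[0, 1] -> cyclic_Ainfty C n pair G E (m t);
  iso_graded : forall t, t \in `[0, 1] -> graded_operations C G E 0 (c t);
  iso_cyclic : forall t b, t \in `[0, 1] -> below G E b ->
    cyclically_symmetric C pair (c t b);
  iso_derivative : forall t b d x, t \in `[0, 1] -> below G E b ->
    homogeneous C d x ->
    exists2 v, curve_derivative (fun s => m s b x) t v &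
      v + insertions G 1 (c t) (m t) b d x
        - insertions G 0 (m t) (c t) b d x = 0;
  iso_m0 : forall t t' x, t \in `[0, 1] -> t' \in `[0, 1] ->
    m t (0, 0) x = m t' (0, 0) x;
  iso_c0 : forall t x, t \in `[0, 1] -> c t (0, 0) x = 0 }.

Record unital_isotopy (R : realType) (V : lmodType R) (C : int -> set V)
    (G : set (R * int)) (E : \bar R) (e : V) (m c : R -> operations V) :
    Prop := {
  unital_iso_m : forall t, t \in `[0, 1] -> is_unit C G E e (m t);
  unital_iso_c : forall t b s1 s2, t \in `[0, 1] -> below G E b ->
    c t b (s1 ++ e :: s2) = 0 }.

(* (b_0, [:: (k_1, b_1); ...; (k_l, b_l)]) with b_0 + ... + b_l = b and
   k_1 + ... + k_l = k; l >= 0 is arbitrary and the k_i may be 0. *)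
Definition decompositions (R : realType) (G : set (R * int)) (b : R * int)
    (k : nat) : set ((R * int) * seq (nat * (R * int))) :=
  [set p | [/\ G p.1, forall q, q \in p.2 -> G q.2,
               p.1 + \sum_(q <- p.2) q.2 = b & sumn (unzip1 p.2) = k]].

(* The sum of the
     g_{l,b_0}(f_{k_1,b_1}(x_1, ...), ..., f_{k_l,b_l}(..., x_k)).
   There are infinitely many indices, but a term with some (k_i, b_i) equal to
   (0, (0, 0)) vanishes when f_{0,(0,0)} = 0, and the others are finitely
   many. *)
Definition compose (R : realType) (V : lmodType R) (G : set (R * int))
    (g f : operations V) : operations V :=
  fun b x => \sum_(p \in decompositions G b (size x))
    g p.1 [seq f q.1 q.2 | q <- zip (unzip2 p.2) (reshape (unzip1 p.2) x)].

Definition identity (R : realType) (V : lmodType R) : operations V :=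
  fun b x => if x is [:: v] then if b == (0, 0) then v else 0 else 0.

(* Filtered A-infinity homomorphism from (V, m) to (V, m'), modulo T^E. *)
Record Ainfty_hom (R : realType) (V : lmodType R) (C : int -> set V)
    (G : set (R * int)) (E : \bar R) (m m' f : operations V) : Prop := {
  hom_graded : graded_operations C G E 0 f;
  hom_f00 : f (0, 0) [::] = 0;
  hom_relation : forall b d x, below G E b -> homogeneous C d x ->
    compose G m' f b x = insertions G 1 f m b d x }.

Record cyclic_hom (R : realType) (V : lmodType R) (pair : V -> V -> R)
    (G : set (R * int)) (E : \bar R) (f : operations V) : Prop := {
  cyclic_hom_isometry : forall x y,
    pair (f (0, 0) [:: x]) (f (0, 0) [:: y]) = pair x y;
  cyclic_hom_vanish : forall b x, below G E b ->
    (size x, b) != (2%N, (0, 0)) ->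
    \sum_(k1 < (size x).+1) \sum_(c \in splittings G b)
      pair (f c.1 (take k1 x)) (f c.2 (drop k1 x)) = 0 }.

Record unital_hom (R : realType) (V : lmodType R) (G : set (R * int))
    (E : \bar R) (e : V) (f : operations V) : Prop := {
  unital_hom1 : f (0, 0) [:: e] = e;
  unital_hom1b : forall b, below G E b -> b != (0, 0) -> f b [:: e] = 0;
  unital_hom_vanish : forall b s1 s2, below G E b ->
    (1 < size (s1 ++ e :: s2))%N -> f b (s1 ++ e :: s2) = 0 }.

Definition has_inverse (R : realType) (V : lmodType R) (C : int -> set V)
    (G : set (R * int)) (E : \bar R) (m m' f : operations V) : Prop :=
  exists g, [/\ Ainfty_hom C G E m' m g,
    forall b x, below G E b -> compose G g f b x = identity b x
  & forall b x, below G E b -> compose G f g b x = identity b x].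

(* Main.v *)
Require Import Defs.
From HB Require Import structures.
From mathcomp Require Import all_boot all_order all_algebra.
From mathcomp Require Import zify lra.
From mathcomp Require Import all_classical all_reals all_analysis.
Import Order.TTheory GRing.Theory Num.Theory.
Import numFieldNormedType.Exports.
Local Open Scope classical_set_scope.
Local Open Scope ring_scope.

(* Let c act on words as a coderivation, and consider for families psi_b of
   multilinear maps the linear equation d psi / dt = psi o c. Since c vanishes
   at energy zero, the component of psi o c at b involves only components of psi
   at smaller energy, so for given initial value there is exactly one solution,
   obtained by finitely many successive integrations at each b. Let
   phi^{s,t}, as a function of t, be the solution which is the identity at
   t = s. Each of the following pairs of families solves the equation in t and
   agrees at t = s:
     m^s o phi^{s,t} and phi^{s,t} o m^t (because dm/dt = m o c - c o m),
     phi^{r,s} o phi^{s,t} and phi^{r,t},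
     the sums of the <phi^{s,t}, phi^{s,t}> and the pairing itself (which is a
     constant solution because c is cyclic).
   Hence f = phi^{1,0} is a cyclic homomorphism with inverse phi^{0,1}. *)

Set Implicit Arguments.
Unset Strict Implicit.
Unset Printing Implicit Defensive.

(** In every family compared, [c] acts from the right only. The equation therefore stays linear in
    psi, and psi may take values in any space (in the reals for sums of pairings), although a
    composite is nonlinear in its inner factor.

    The comparison of phi o m with m o phi rests on (phi o c) o m + phi o (m o c - c o m) = (phi o
    m) o c. Insertion is not associative, so this is a statement on commutators of coderivations.
    Koszul signs enter through a parity operator, with which [c] commutes because its degree is
    even.

    Two obstacles shape the rest. The space carries no topology: derivatives are those of finite
    sums of scalar functions times fixed vectors, and constancy and degree are tested by linear
    forms and projections instead of limits. And composition is a sum over infinitely many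
    decompositions: the rank of the label plus the length of the word bounds the number of inner
    factors in a nonzero term, so that differentiation can be done term by term. *)

(** * Sums over deconcatenations of a word *)

Section Cuts.
Variables (T : Type) (W : nmodType).
Implicit Types (F : seq T -> seq T -> W) (x : seq T).

(** The deconcatenation coproduct followed by [F]. Recursion on the word avoids index arithmetic;
    [cutsumE] is the translation to [take] and [drop]. *)
Fixpoint cutsum F x : W :=
  F [::] x + (if x is v :: r then cutsum (fun a => F (v :: a)) r else 0).

Lemma eq_cutsum F1 F2 x :
  (forall a b, a ++ b = x -> F1 a b = F2 a b) -> cutsum F1 x = cutsum F2 x.
Proof.
elim: x F1 F2 => [|v x IHx] F1 F2 eqF /=; rewrite eqF //.
by congr (_ + _); apply: IHx => a b e; apply: eqF; rewrite /= e.
Qed.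

Lemma cutsumD F1 F2 x :
  cutsum (fun a b => F1 a b + F2 a b) x = cutsum F1 x + cutsum F2 x.
Proof.
elim: x F1 F2 => [|v x IHx] F1 F2 /=; first by rewrite !addr0.
by rewrite IHx addrACA.
Qed.

Lemma cutsum0 F x : (forall a b, a ++ b = x -> F a b = 0) -> cutsum F x = 0.
Proof.
elim: x F => [|v x IHx] F F0 /=; rewrite F0 ?add0r//.
by apply: IHx => a b e; apply: F0; rewrite /= e.
Qed.

Lemma cutsum_sum I (r : seq I) (F : I -> seq T -> seq T -> W) x :
  cutsum (fun a b => \sum_(i <- r) F i a b) x = \sum_(i <- r) cutsum (F i) x.
Proof.
elim: r => [|i r IHr]; first by rewrite big_nil cutsum0 // => ? ? _; rewrite big_nil.
by rewrite big_cons -IHr -cutsumD; apply: eq_cutsum => ? ? _; rewrite big_cons.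
Qed.

Lemma cutsumE F x :
  cutsum F x = \sum_(k < (size x).+1) F (take k x) (drop k x).
Proof.
elim: x F => [|v x IHx] F /=.
  by rewrite big_ord_recl big_ord0.
by rewrite big_ord_recl take0 drop0 IHx.
Qed.

Lemma cutsum_exchange (F : seq T -> seq T -> seq T -> seq T -> W) x y :
  cutsum (fun a b => cutsum (F a b) y) x =
  cutsum (fun c d => cutsum (fun a b => F a b c d) x) y.
Proof.
rewrite !cutsumE (eq_bigr _ (fun i _ => cutsumE _ _)) exchange_big.
by apply: eq_bigr => i _; rewrite cutsumE.
Qed.

(** A cut leaves the marked letter [v] either in the right piece or in the left one. *)
Lemma cutsum_mark F a v z :
  cutsum F (a ++ v :: z) = cutsum (fun a1 a2 => F a1 (a2 ++ v :: z)) a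
                         + cutsum (fun z1 z2 => F (a ++ v :: z1) z2) z.
Proof.
elim: a F => [|u a IHa] F /=; first by rewrite addr0.
by rewrite IHa addrA.
Qed.

(** Coassociativity: either side runs over the factorizations of [x] into three words. *)
Lemma cutsum_assoc (F : seq T -> seq T -> seq T -> W) x :
  cutsum (fun l c => cutsum (fun a b => F a b c) l) x =
  cutsum (fun a r => cutsum (F a) r) x.
Proof.
elim: x F => [|v x IHx] F /=; first by rewrite !addr0.
by rewrite cutsumD IHx addr0 addrA.
Qed.

Lemma cutsum_left F x : (forall v a b, F (v :: a) b = 0) -> cutsum F x = F [::] x.
Proof.
case: x => [|v x] F0 /=; first by rewrite addr0.
by rewrite cutsum0 ?addr0// => a b _; apply: F0.
Qed.

Lemma cutsum_right F x : (forall a v b, F a (v :: b) = 0) -> cutsum F x = F x [::].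
Proof.
elim: x F => [|v x IHx] F F0 /=; first by rewrite addr0.
by rewrite F0 add0r IHx.
Qed.

(** Only the cut before the last letter counts. This links sums over cuts to the [belast] and [last]
    of cyclic symmetry. *)
Lemma cutsum_last (F : seq T -> T -> W) (x0 : T) (r : seq T) :
  cutsum (fun y z => if z is [:: v] then F y v else 0) (x0 :: r) =
  F (belast x0 r) (last x0 r).
Proof.
elim: r x0 F => [|x1 r IHr] x0 F; first by rewrite /= !addr0.
by rewrite /= add0r -(IHr x1 (fun y => F (x0 :: y))).
Qed.

End Cuts.

Lemma cutsum_map (T T' : Type) (W : nmodType) (h : T -> T')
    (F : seq T' -> seq T' -> W) x :
  cutsum F (map h x) = cutsum (fun a b => F (map h a) (map h b)) x.
Proof. by elim: x F => [|v x IHx] F //=; rewrite IHx. Qed.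

Lemma raddf_cutsum (T : Type) (W W' : nmodType) (h : W -> W')
    (F : seq T -> seq T -> W) x :
  {morph h : u v / u + v} -> h 0 = 0 ->
  h (cutsum F x) = cutsum (fun a b => h (F a b)) x.
Proof.
move=> hD h0.
by elim: x F => [|v x IHx] F /=; rewrite hD ?h0 ?IHx.
Qed.

(** * Insertions and coderivations *)

Section Insertion.
Variables (R : pzRingType) (V : lmodType R).

(** Same condition as [multilinear], but with values in any module, as needed for real-valued sums
    of pairings. *)
Definition multilin (W : lmodType R) (p : seq V -> W) : Prop :=
  forall s1 s2, linear (fun v => p (s1 ++ v :: s2)).

(* sg is the identity, or the parity operator, which carries the Koszul signs. *)
Definition insert (W : lmodType R) (sg : V -> V) (p : seq V -> W)
    (q : seq V -> V) (x : seq V) : W :=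
  cutsum (fun a r => cutsum (fun y z => p (map sg a ++ q y :: z)) r) x.

Variable W : lmodType R.
Implicit Types (p : seq V -> W) (q : seq V -> V) (sg : V -> V).

Lemma linear0P (U : lmodType R) (h : U -> W) : linear h -> h 0 = 0.
Proof. by move=> hl; have := hl (-1) 0 0; rewrite scaler0 addr0 scaleN1r addNr. Qed.

Lemma linearDP (U : lmodType R) (h : U -> W) :
  linear h -> {morph h : u v / u + v}.
Proof. by move=> hl u v; have := hl 1 u v; rewrite !scale1r. Qed.

Lemma linearZP (U : lmodType R) (h : U -> W) a u :
  linear h -> h (a *: u) = a *: h u.
Proof. by move=> hl; have := hl a u 0; rewrite !addr0 linear0P// addr0. Qed.

Lemma linear_sumP (U : lmodType R) I (r : seq I) (F : I -> U -> W) :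
  (forall i, linear (F i)) -> linear (fun v => \sum_(i <- r) F i v).
Proof.
move=> Fl a u v; rewrite scaler_sumr -big_split.
by apply: eq_bigr => i _; rewrite Fl.
Qed.

Lemma linear_addP (U : lmodType R) (h1 h2 : U -> W) :
  linear h1 -> linear h2 -> linear (fun v => h1 v + h2 v).
Proof. by move=> l1 l2 a u v; rewrite l1 l2 scalerDr addrACA. Qed.

Lemma linear_cutsum (U : lmodType R) T (F : U -> seq T -> seq T -> W) x :
  (forall a b, linear (fun v => F v a b)) -> linear (fun v => cutsum (F v) x).
Proof.
move=> Fl a u v; rewrite !cutsumE scaler_sumr -big_split.
by apply: eq_bigr => i _; rewrite Fl.
Qed.

(** The inserted block lies to the left of the letter [v], contains it, or lies to its right; in the
    last case [v] itself passes through [sg]. *)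
Lemma insert_mark sg p q a v z :
  insert sg p q (a ++ v :: z) =
    insert sg (fun w => p (w ++ v :: z)) q a
  + cutsum (fun a1 a2 =>
      cutsum (fun z1 z2 => p (map sg a1 ++ q (a2 ++ v :: z1) :: z2)) z) a
  + insert sg (fun w => p (map sg a ++ sg v :: w)) q z.
Proof.
rewrite /insert cutsum_mark; congr (_ + _).
  rewrite -cutsumD; apply: eq_cutsum => a1 a2 _.
  rewrite cutsum_mark; congr (_ + _).
  by apply: eq_cutsum => y w _; rewrite -catA.
apply: eq_cutsum => z1 z2 _; apply: eq_cutsum => y w _.
by rewrite map_cat /= -catA.
Qed.

Lemma multilin_insert sg p q : linear sg ->
  multilin p -> multilin q -> multilin (insert sg p q).
Proof.
move=> sgl pl ql s1 s2.
have e v := insert_mark sg p q s1 v s2.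
move=> a u v; rewrite !e; move: {e} a u v.
apply: (@linear_addP V); first apply: (@linear_addP V).
- apply: linear_cutsum => a b; apply: linear_cutsum => y z a' u v.
  by rewrite pl.
- apply: linear_cutsum => a b; apply: linear_cutsum => y z a' u v.
  by rewrite ql pl.
- apply: linear_cutsum => a b; apply: linear_cutsum => y z a' u v.
  by rewrite sgl pl.
Qed.

Lemma eq_insert sg p1 p2 q x : p1 =1 p2 -> insert sg p1 q x = insert sg p2 q x.
Proof. by move=> e; do 2! apply: eq_cutsum => ? ? _. Qed.

Lemma insert0l sg q x : insert sg (fun _ => 0 : W) q x = 0.
Proof. by do 2! apply: cutsum0 => ? ? _. Qed.

Lemma insert_suml sg I (r : seq I) (p : I -> seq V -> W) q x :
  insert sg (fun w => \sum_(i <- r) p i w) q x =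
  \sum_(i <- r) insert sg (p i) q x.
Proof.
rewrite /insert -cutsum_sum; apply: eq_cutsum => a b _.
by rewrite -cutsum_sum.
Qed.

Lemma insert_sumr sg I (r : seq I) p (q : I -> seq V -> V) x : multilin p ->
  insert sg p (fun w => \sum_(i <- r) q i w) x =
  \sum_(i <- r) insert sg p (q i) x.
Proof.
move=> pl; rewrite /insert -cutsum_sum; apply: eq_cutsum => a b _.
rewrite -cutsum_sum; apply: eq_cutsum => y z _.
elim: r => [|i r IHr]; first by rewrite !big_nil (linear0P (pl _ _)).
by rewrite !big_cons (linearDP (pl _ _)) IHr.
Qed.

Lemma insertBr sg p q1 q2 x : multilin p ->
  insert sg p (fun w => q1 w - q2 w) x = insert sg p q1 x - insert sg p q2 x.
Proof.
move=> pl; apply/esym/eqP; rewrite subr_eq; apply/eqP.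
rewrite /insert -cutsumD; apply: eq_cutsum => a r _.
rewrite -cutsumD; apply: eq_cutsum => y z _.
by rewrite -(linearDP (pl _ _)) subrK.
Qed.

Lemma insert0r sg p q x : multilin p -> q =1 (fun=> 0) -> insert sg p q x = 0.
Proof.
move=> pl q0; apply: cutsum0 => a b _; apply: cutsum0 => y z _.
by rewrite q0 (linear0P (pl _ _)).
Qed.

(** Leibniz rule: insertion of [q] is a coderivation, since the letter created by [q] falls into
    exactly one of the two pieces. *)
Lemma insert_cutsum (F : seq V -> seq V -> W) q x :
  insert id (cutsum F) q x =
  cutsum (fun x1 x2 => insert id (F^~ x2) q x1 + insert id (F x1) q x2) x.
Proof.
(* The letter [q y] lies to the right of the cut in [A] and to the left of it in [B]. *)
pose A a1 a2 y z := F a1 (a2 ++ q y :: z).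
pose B a y z1 z2 := F (a ++ q y :: z1) z2.
have -> : insert id (cutsum F) q x =
    cutsum (fun a r => cutsum (fun y z => cutsum (fun a1 a2 => A a1 a2 y z) a) r) x
  + cutsum (fun a r => cutsum (fun y z => cutsum (fun z1 z2 => B a y z1 z2) z) r) x.
  rewrite -cutsumD; apply: eq_cutsum => a r _.
  rewrite -cutsumD; apply: eq_cutsum => y z _.
  by rewrite map_id cutsum_mark.
rewrite cutsumD addrC; congr (_ + _).
  rewrite -[RHS]/(cutsum (fun x1 x2 => cutsum (fun a r =>
    cutsum (fun y z => F (map id a ++ q y :: z) x2) r) x1) x).
  rewrite cutsum_assoc; apply: eq_cutsum => a r _.
  rewrite -(cutsum_assoc (fun y z1 z2 => B a y z1 z2)).
  by do 2! apply: eq_cutsum => ? ? _; rewrite map_id.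
transitivity (cutsum (fun a r => cutsum (fun a1 a2 =>
      cutsum (fun y z => A a1 a2 y z) r) a) x).
  by apply: eq_cutsum => a r _; rewrite cutsum_exchange.
rewrite (cutsum_assoc (fun a1 a2 r => cutsum (fun y z => A a1 a2 y z) r)).
by do 3! apply: eq_cutsum => ? ? _; rewrite map_id.
Qed.

Lemma raddf_insert (h : V -> W) sg (p q : seq V -> V) x : linear h ->
  h (insert sg p q x) = insert sg (fun w => h (p w)) q x.
Proof.
move=> hl; have [hD h0] := (linearDP hl, linear0P hl).
by rewrite /insert raddf_cutsum//; apply: eq_cutsum => a r _; rewrite raddf_cutsum.
Qed.

(** Two bracketings of the sum over factorizations of [x] into five words. The words [w] and [y]
    will be disjoint blocks, [w] on the left. *)
Lemma cut5_left (H : seq V -> seq V -> seq V -> seq V -> seq V -> W) x :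
  cutsum (fun a => cutsum (fun y z => cutsum (fun a1 => cutsum (fun w a2 =>
    H a1 w a2 y z)) a)) x =
  cutsum (fun a => cutsum (fun w => cutsum (fun a2 => cutsum (fun y z =>
    H a w a2 y z)))) x.
Proof.
transitivity (cutsum (fun a r => cutsum (fun a1 => cutsum (fun w a2 =>
    cutsum (H a1 w a2) r)) a) x).
  apply: eq_cutsum => a r _; rewrite cutsum_exchange.
  by apply: eq_cutsum => a1 a' _; rewrite cutsum_exchange.
rewrite (cutsum_assoc (fun a1 a' r => cutsum (fun w a2 =>
    cutsum (H a1 w a2) r) a')).
by apply: eq_cutsum => a1 r _; rewrite cutsum_assoc.
Qed.

(** The analogue for nested blocks: [y] lies inside the block made of [a2], [y] and [z1]. *)
Lemma cut5_nest (H : seq V -> seq V -> seq V -> seq V -> seq V -> W) x :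
  cutsum (fun a => cutsum (fun y z => cutsum (fun a1 a2 => cutsum (fun z1 z2 =>
    H a1 a2 y z1 z2) z) a)) x =
  cutsum (fun a => cutsum (fun r z2 => cutsum (fun a2 => cutsum (fun y z1 =>
    H a a2 y z1 z2)) r)) x.
Proof.
transitivity (cutsum (fun a r => cutsum (fun a1 a2 =>
    cutsum (fun y => cutsum (H a1 a2 y)) r) a) x).
  by apply: eq_cutsum => a r _; rewrite cutsum_exchange.
rewrite (cutsum_assoc (fun a1 a2 r => cutsum (fun y => cutsum (H a1 a2 y)) r)).
apply: eq_cutsum => a1 r _.
rewrite (cutsum_assoc (fun a2 r' z2 => cutsum (fun y z1 => H a1 a2 y z1 z2) r')).
by apply: eq_cutsum => a2 r' _; rewrite cutsum_assoc.
Qed.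

(* The commutator of two coderivations is a coderivation: insertions of m and
   of c at disjoint places cancel, those of one into the other remain. *)
Lemma insert_commutator sg p (c m : seq V -> V) x : linear sg ->
  multilin p -> (forall w, sg (c w) = c (map sg w)) ->
  insert sg (insert id p c) m x + insert sg p (insert id m c) x =
  insert id (insert sg p m) c x + insert sg p (insert sg c m) x.
Proof.
move=> sgl pl sgc.
(* Relative positions of the two blocks: in [X1] that of [c] is left of that of [m], in [X2] [m] is
   inside [c], in [X3] [m] is left of [c], in [X4] [c] is inside [m]. *)
pose X1 := cutsum (fun a => cutsum (fun w => cutsum (fun a2 => cutsum (fun y z =>
  p (map sg a ++ c (map sg w) :: map sg a2 ++ m y :: z))))) x.
pose X2 := cutsum (fun a => cutsum (fun r z2 => cutsum (fun u => cutsum (fun y z1 =>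
  p (map sg a ++ c (map sg u ++ m y :: z1) :: z2))) r)) x.
pose X3 := cutsum (fun a => cutsum (fun y => cutsum (fun z1 => cutsum (fun w z2 =>
  p (map sg a ++ m y :: z1 ++ c w :: z2))))) x.
pose X4 := cutsum (fun a => cutsum (fun r z2 => cutsum (fun u => cutsum (fun y z1 =>
  p (map sg a ++ m (u ++ c y :: z1) :: z2))) r)) x.
have -> : insert sg (insert id p c) m x = X1 + X2 + X3.
  rewrite /X1 /X2 -cut5_left -cut5_nest -!cutsumD.
  apply: eq_cutsum => a r _; rewrite -!cutsumD; apply: eq_cutsum => y z _.
  rewrite insert_mark; congr (_ + _ + _).
  - rewrite /insert cutsum_map; apply: eq_cutsum => a1 a' _.
    rewrite cutsum_map; apply: eq_cutsum => w a2 _.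
    by rewrite map_id -catA.
  - rewrite cutsum_map; do 2! apply: eq_cutsum => ? ? _.
    by rewrite map_id.
  - do 2! apply: eq_cutsum => ? ? _.
    by rewrite !map_id.
have -> : insert sg p (insert id m c) x = X4.
  apply: eq_cutsum => a r _; apply: eq_cutsum => y z _.
  rewrite (raddf_insert (h := fun v => p (map sg a ++ v :: z)))//.
  by do 2! apply: eq_cutsum => ? ? _; rewrite map_id.
have -> : insert sg p (insert sg c m) x = X2.
  apply: eq_cutsum => a r _; apply: eq_cutsum => y z _.
  by rewrite (raddf_insert (h := fun v => p (map sg a ++ v :: z))).
suff -> : insert id (insert sg p m) c x = X3 + X4 + X1.
  by rewrite -[LHS]addrA addrC addrA.
rewrite /X3 /X4 -cut5_left -cut5_nest -!cutsumD.
apply: eq_cutsum => a r _; rewrite -!cutsumD; apply: eq_cutsum => y z _.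
rewrite insert_mark !map_id; congr (_ + _ + _).
- by do 2! apply: eq_cutsum => ? ? _; rewrite -catA.
(* With [m] to the right of [c], [sg] acts here on the value of [c] and in [X1] on its arguments;
   these agree by [sgc]. *)
- by do 2! apply: eq_cutsum => ? ? _; rewrite sgc.
Qed.

End Insertion.

(** * Convolution over the gapped monoid *)

Definition splits (R : realType) (G : set (R * int)) (b : R * int) :
    seq ((R * int) * (R * int)) :=
  finmap.enum_fset (fset_set (splittings G b)).

Definition bsum (R : realType) (G : set (R * int)) (W : nmodType) (b : R * int)
    (F : R * int -> R * int -> W) : W :=
  \sum_(c <- splits G b) F c.1 c.2.

(* What is used of a gapped monoid: finitely many splittings, and a rank that
   drops when a nonzero summand is removed. *)
Record ranked (R : realType) (G : set (R * int)) (rank : R * int -> nat) :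
    Prop := {
  ranked0 : G 0;
  rankedD : forall b b', G b -> G b' -> G (b + b');
  ranked_splits : forall b, finite_set (splittings G b);
  ranked_lt : forall b b', G b -> G b' -> b' != 0 ->
    (rank b < rank (b + b')%R)%N }.

Section Splittings.
Variables (R : realType) (G : set (R * int)) (rank : R * int -> nat).
Hypothesis rG : ranked G rank.
Variable W : nmodType.
Implicit Types (b : R * int) (F : R * int -> R * int -> W).
Local Notation bsum := (bsum G).

Lemma splitsP b c :
  reflect [/\ G c.1, G c.2 & c.1 + c.2 = b] (c \in splits G b).
Proof.
rewrite /splits in_fset_set; last exact: (ranked_splits rG).
by apply: (iffP idP); rewrite inE.
Qed.

Lemma splits_uniq b : uniq (splits G b).
Proof. exact: finmap.fset_uniq. Qed.

Lemma eq_bsum b F1 F2 :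
  (forall b1 b2, G b1 -> G b2 -> b1 + b2 = b -> F1 b1 b2 = F2 b1 b2) ->
  bsum b F1 = bsum b F2.
Proof.
move=> e; rewrite /bsum !big_seq; apply: eq_bigr => c /splitsP[g1 g2 gb].
exact: e.
Qed.

Lemma bsum0 b F :
  (forall b1 b2, G b1 -> G b2 -> b1 + b2 = b -> F b1 b2 = 0) -> bsum b F = 0.
Proof.
move=> e; rewrite /bsum big_seq big1// => c /splitsP[g1 g2 gb].
exact: e.
Qed.

Lemma bsumD b F1 F2 :
  bsum b (fun b1 b2 => F1 b1 b2 + F2 b1 b2) = bsum b F1 + bsum b F2.
Proof. exact: big_split. Qed.

Lemma bsum_cutsum T b (F : R * int -> R * int -> seq T -> seq T -> W) x :
  bsum b (fun b1 b2 => cutsum (F b1 b2) x) =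
  cutsum (fun x1 x2 => bsum b (fun b1 b2 => F b1 b2 x1 x2)) x.
Proof. by rewrite /bsum -cutsum_sum. Qed.

Lemma bsumC b F : bsum b F = bsum b (fun b1 b2 => F b2 b1).
Proof.
rewrite /bsum -(big_map (fun c => (c.2, c.1)) xpredT (fun c => F c.2 c.1)).
apply/esym/perm_big; apply: uniq_perm; first exact: splits_uniq.
  by rewrite map_inj_uniq ?splits_uniq// => -[? ?] [? ?] [-> ->].
move=> [b1 b2]; apply/splitsP/mapP => [/= [g1 g2 gb]|[[b1' b2'] + [-> ->]]].
  by exists (b2, b1) => //; apply/splitsP; rewrite addrC.
by move=> /splitsP[/=]; rewrite addrC.
Qed.

(** Associativity of convolution: the lists of triples on both sides are permutations of each other,
    closure of [G] under addition providing the partial sums. *)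
Lemma bsumA b (F : R * int -> R * int -> R * int -> W) :
  bsum b (fun r b3 => bsum r (fun b1 b2 => F b1 b2 b3)) =
  bsum b (fun b1 r => bsum r (F b1)).
Proof.
pose l := [seq (d, c.2) | c <- splits G b, d <- splits G c.1].
pose r := [seq ((c.1, d.1), d.2) | c <- splits G b, d <- splits G c.2].
transitivity (\sum_(t <- l) F t.1.1 t.1.2 t.2); first by rewrite big_allpairs_dep.
transitivity (\sum_(t <- r) F t.1.1 t.1.2 t.2); last by rewrite big_allpairs_dep.
apply: perm_big; apply: uniq_perm.
- apply: allpairs_uniq_dep => [|c _|]; try exact: splits_uniq.
  move=> p1 p2 /allpairsPdep[[? ?] [[? ?] [/splitsP/= [_ _ _] /splitsP/= [_ _ e1] ->]]].
  move=> /allpairsPdep[[? ?] [[? ?] [/splitsP/= [_ _ _] /splitsP/= [_ _ e2] ->]]] /=.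
  by move=> [? ? ?]; subst.
- apply: allpairs_uniq_dep => [|c _|]; try exact: splits_uniq.
  move=> p1 p2 /allpairsPdep[[? ?] [[? ?] [/splitsP/= [_ _ _] /splitsP/= [_ _ e1] ->]]].
  move=> /allpairsPdep[[? ?] [[? ?] [/splitsP/= [_ _ _] /splitsP/= [_ _ e2] ->]]] /=.
  by move=> [? ? ?]; subst.
move=> [[b1 b2] b3]; apply/allpairsPdep/allpairsPdep.
  move=> [[c1 c3] [[d1 d2] [/splitsP/= [_ g3 <-] /splitsP/= [g1 g2 <-] [-> -> ->]]]].
  exists (d1, d2 + c3), (d2, c3); split => //; apply/splitsP; split => //=.
    exact: (rankedD rG).
  by rewrite addrA.
move=> [[c1 c2] [[d1 d2] [/splitsP/= [g1 _ <-] /splitsP/= [g2 g3 <-] [-> -> ->]]]].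
exists (c1 + d1, d2), (c1, d1); split => //; apply/splitsP; split => //=.
  exact: (rankedD rG).
by rewrite addrA.
Qed.

Lemma bsum_single b F : G b ->
  (forall b1 b2, b1 != 0 -> F b1 b2 = 0) -> bsum b F = F 0 b.
Proof.
move=> gb F0; have mem0 : (0, b) \in splits G b.
  by apply/splitsP; split => //=; [exact: ranked0 rG | rewrite add0r].
rewrite /bsum (bigD1_seq _ mem0) ?splits_uniq//= big_seq_cond big1 ?addr0//.
move=> [b1 b2] /andP[/splitsP/= [_ _ e] ne]; apply: F0.
by apply: contraNneq ne => b10; move: e; rewrite b10 add0r => ->.
Qed.

End Splittings.

Lemma raddf_bsum (R : realType) (G : set (R * int)) (W W' : nmodType)
    (h : W -> W') b (F : R * int -> R * int -> W) :
  {morph h : u v / u + v} -> h 0 = 0 ->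
  h (bsum G b F) = bsum G b (fun b1 b2 => h (F b1 b2)).
Proof. by move=> hD h0; rewrite /bsum (big_morph h hD h0). Qed.

(** * Families indexed by labels: insertion and composition *)

Section Derivations.
Variables (R : realType) (G : set (R * int)) (rank : R * int -> nat).
Hypothesis rG : ranked G rank.
Variables (V W : lmodType R).
Local Notation bsum := (bsum G).

(** The product p o q of families: insertion on words, convolution on labels. *)
Definition ins (W : lmodType R) (sg : V -> V) (p : R * int -> seq V -> W)
    (q : operations V) (b : R * int) (x : seq V) : W :=
  bsum b (fun b1 b2 => insert sg (p b1) (q b2) x).

Implicit Types (p : R * int -> seq V -> W) (q : operations V).

Lemma multilin_bsum (F : R * int -> R * int -> seq V -> W) b :
  (forall b1 b2, multilin (F b1 b2)) ->
  multilin (fun x => bsum b (fun b1 b2 => F b1 b2 x)).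
Proof. by move=> Fl s1 s2; apply: linear_sumP => c; apply: Fl. Qed.

Lemma multilin_ins sg p q b : linear sg ->
  (forall b, multilin (p b)) -> (forall b, multilin (q b)) ->
  multilin (ins sg p q b).
Proof.
move=> sgl pl ql.
apply: (multilin_bsum (F := fun b1 b2 => insert sg (p b1) (q b2))) => b1 b2.
exact: multilin_insert.
Qed.

Lemma ins_commutator sg p (c m : operations V) b x : linear sg ->
  (forall b, multilin (p b)) -> (forall b w, sg (c b w) = c b (map sg w)) ->
  ins sg (ins id p c) m b x + ins sg p (ins id m c) b x =
  ins id (ins sg p m) c b x + ins sg p (ins sg c m) b x.
Proof.
move=> sgl pl sgc.
have expl s1 s2 q1 q2 : ins s1 (ins s2 p q1) q2 b x =
    bsum b (fun b1 r => bsum r (fun b2 b3 =>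
      insert s1 (insert s2 (p b1) (q1 b2)) (q2 b3) x)).
  rewrite -(bsumA rG); apply: (eq_bsum rG) => b1 b2 _ _ _.
  exact: insert_suml.
have expr s1 s2 q1 q2 : ins s1 p (ins s2 q1 q2) b x =
    bsum b (fun b1 r => bsum r (fun b2 b3 =>
      insert s1 (p b1) (insert s2 (q1 b2) (q2 b3)) x)).
  by apply: (eq_bsum rG) => b1 b2 _ _ _; apply: insert_sumr.
rewrite !expl !expr -!bsumD; apply: (eq_bsum rG) => b1 r _ _ _.
(* In two of the four terms the labels of [c] and [m] come in the opposite order. *)
rewrite (bsumC rG _ (fun b2 b3 => insert _ (p b1) (insert id _ _) _)).
rewrite (bsumC rG _ (fun b2 b3 => insert id (insert _ (p b1) _) _ _)).
rewrite -!bsumD; apply: (eq_bsum rG) => b2 b3 _ _ _.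
exact: insert_commutator.
Qed.

(* The summand of [compose G p f] with exactly l inner factors f. *)
Fixpoint blocks (l : nat) (p : R * int -> seq V -> W) (f : operations V)
    (b : R * int) (x : seq V) : W :=
  if l is l'.+1 then
    bsum b (fun b1 b2 => cutsum (fun x1 x2 =>
      blocks l' (fun b' y => p b' (f b1 x1 :: y)) f b2 x2) x)
  else if x is [::] then p b [::] else 0.

Lemma eq_blocks l p1 p2 f b x : (forall b x, p1 b x = p2 b x) ->
  blocks l p1 f b x = blocks l p2 f b x.
Proof.
elim: l p1 p2 b x => [|l IHl] p1 p2 b x e /=; first by case: x.
by apply: (eq_bsum rG) => *; apply: eq_cutsum => *; apply: IHl.
Qed.

Lemma blocks0 l f b x : blocks l (fun _ _ => 0) f b x = 0.
Proof.
elim: l b x => [|l IHl] b x /=; first by case: x.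
by apply: (bsum0 rG) => *; apply: cutsum0 => *; apply: IHl.
Qed.

Lemma blocksD l p1 p2 f b x :
  blocks l (fun b x => p1 b x + p2 b x) f b x =
  blocks l p1 f b x + blocks l p2 f b x.
Proof.
elim: l p1 p2 b x => [|l IHl] p1 p2 b x /=; first by case: x; rewrite ?addr0.
rewrite -bsumD; apply: (eq_bsum rG) => *; rewrite -cutsumD.
by apply: eq_cutsum => *; rewrite IHl.
Qed.

Lemma linear_blocks (U : lmodType R) l (p : U -> R * int -> seq V -> W) f b x :
  (forall b x, linear (fun u => p u b x)) ->
  linear (fun u => blocks l (p u) f b x).
Proof.
elim: l p b x => [|l IHl] p b x pl /=.
  by case: x => [|? ?]; [apply: pl | move=> a u v; rewrite scaler0 addr0].
apply: linear_sumP => c; apply: linear_cutsum => x1 x2.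
by apply: IHl => b' y; apply: pl.
Qed.

Lemma multilin_cons (p : seq V -> W) v : multilin p -> multilin (fun y => p (v :: y)).
Proof. by move=> pl s1 s2; apply: (pl (v :: s1)). Qed.

Lemma multilin_blocks l p f b : (forall b, multilin (p b)) ->
  (forall b, multilin (f b)) -> multilin (blocks l p f b).
Proof.
elim: l p b => [|l IHl] p b pl fl /=.
  by move=> [|? ?] s2 a u v; rewrite /= scaler0 addr0.
apply: multilin_bsum => b1 b2 s1 s2.
have e v := cutsum_mark (fun x1 x2 =>
  blocks l (fun b' y => p b' (f b1 x1 :: y)) f b2 x2) s1 v s2.
move=> a u v; rewrite !e; move: {e} a u v; apply: linear_addP.
  apply: linear_cutsum => a b'; apply: IHl => // b''.
  exact: multilin_cons.
apply: linear_cutsum => x1 x2; apply: linear_blocks => b' y a u v.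
by rewrite fl (pl _ [::]).
Qed.

(** Each inner factor consumes exactly one letter and carries the label 0, so the number of factors
    must be the length of the word. *)
Lemma blocks_identity l p b x : (forall b, multilin (p b)) -> G b ->
  blocks l p (@identity R V) b x = if size x == l then p b x else 0.
Proof.
elim: l p b x => [|l IHl] p b x pl gb /=; first by case: x.
have step (b1 b2 : R * int) (x1 x2 : seq V) : (b1 != 0) || (size x1 != 1%N) ->
    blocks l (fun b' y => p b' (identity b1 x1 :: y)) (@identity R V) b2 x2 = 0.
  move=> h; rewrite (@eq_blocks _ _ (fun _ _ => 0)); last first.
    move=> b' y; have -> : identity b1 x1 = 0 :> V.
      by case: x1 h => [|v [|? ?]]//=; rewrite orbF => /negbTE->.
    exact: (linear0P (pl b' [::] y)).
  exact: blocks0.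
rewrite (bsum_single rG)//; last first.
  by move=> b1 b2 b10; apply: cutsum0 => x1 x2 _; apply: step; rewrite b10.
pose F x1 x2 := blocks l (fun b' y => p b' (identity 0 x1 :: y)) (@identity R V) b x2.
have F0 x1 x2 : size x1 != 1%N -> F x1 x2 = 0 by move=> h; apply: step; rewrite h orbT.
case: x => [|v x].
  by rewrite -[LHS]/(F [::] [::] + 0) addr0 F0.
rewrite -[LHS]/(F [::] (v :: x) + cutsum (fun a => F (v :: a)) x) F0// add0r.
rewrite cutsum_left => [|u x1 x2]; last exact: F0.
by rewrite /F /= eqxx IHl// => b'; apply: multilin_cons.
Qed.

(** The labelled form of [insert_cutsum]: the label of [c] is absorbed into that of the piece in
    which [c] acts. *)
Lemma ins_convolution (H : R * int -> R * int -> seq V -> seq V -> W)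
    (c : operations V) b x :
  ins id (fun b' w => bsum b' (fun b1 b2 => cutsum (H b1 b2) w)) c b x =
  bsum b (fun b1 b2 => cutsum (fun x1 x2 =>
      ins id (fun b' w => H b' b2 w x2) c b1 x1
    + ins id (fun b' => H b1 b' x1) c b2 x2) x).
Proof.
pose A b1 b2 b3 := cutsum (fun x1 x2 =>
  insert id (fun w => H b1 b2 w x2) (c b3) x1) x.
pose B b1 b2 b3 := cutsum (fun x1 x2 => insert id (H b1 b2 x1) (c b3) x2) x.
transitivity (bsum b (fun r b3 => bsum r (fun b1 b2 => A b1 b2 b3 + B b1 b2 b3))).
  apply: (eq_bsum rG) => r b3 _ _ _.
  transitivity (bsum r (fun b1 b2 => insert id (cutsum (H b1 b2)) (c b3) x)).
    exact: insert_suml.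
  by apply: (eq_bsum rG) => b1 b2 _ _ _; rewrite insert_cutsum cutsumD.
transitivity (bsum b (fun r b3 => bsum r (fun b1 b2 => A b1 b2 b3)) +
              bsum b (fun b1 r => bsum r (B b1))).
  rewrite -(bsumA rG b B) -bsumD; apply: (eq_bsum rG) => b1 r _ _ _.
  by rewrite bsumD.
rewrite (bsumA rG b A) -bsumD.
transitivity (bsum b (fun b1 r => bsum r (fun b3 b2 => A b1 b2 b3) + bsum r (B b1))).
  by apply: (eq_bsum rG) => b1 r _ _ _; rewrite (bsumC rG).
rewrite bsumD -(bsumA rG b (fun b1 b3 b2 => A b1 b2 b3)) -bsumD.
apply: (eq_bsum rG) => b1 b2 _ _ _.
by rewrite cutsumD !bsum_cutsum.
Qed.

Lemma multilin_convolution (H : R * int -> R * int -> seq V -> seq V -> W) b :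
  (forall b1 b2 x2, multilin (H b1 b2 ^~ x2)) ->
  (forall b1 b2 x1, multilin (H b1 b2 x1)) ->
  multilin (fun x => bsum b (fun b1 b2 => cutsum (H b1 b2) x)).
Proof.
move=> Hl Hr; apply: multilin_bsum => b1 b2 s1 s2 a u v.
rewrite !cutsum_mark; move: a u v.
apply: (linear_addP (h1 := fun v => cutsum _ s1)); apply: linear_cutsum => x1 x2.
  exact: Hr.
exact: Hl.
Qed.

(** By the Leibniz rule [c] acts either on the word of the first inner factor or on the remaining
    word. In the first case linearity of [p] in its first entry moves the sum inside. *)
Lemma ins_blocks l p f c b x : (forall b, multilin (p b)) ->
  ins id (blocks l.+1 p f) c b x =
  bsum b (fun b1 b2 => cutsum (fun x1 x2 =>
      blocks l (fun b' y => p b' (ins id f c b1 x1 :: y)) f b2 x2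
    + ins id (blocks l (fun b' y => p b' (f b1 x1 :: y)) f) c b2 x2) x).
Proof.
move=> pl; rewrite ins_convolution; apply: (eq_bsum rG) => b1 b2 _ _ _.
apply: eq_cutsum => x1 x2 _; congr (_ + _).
pose h v := blocks l (fun b' y => p b' (v :: y)) f b2 x2.
have hl : linear h.
  apply: (@linear_blocks V l (fun v b' y => p b' (v :: y))) => b' y.
  exact: (pl b' [::] y).
rewrite -[RHS]/(h _) (raddf_bsum _ _ _ (linearDP hl) (linear0P hl)).
by apply: (eq_bsum rG) => b1' b3 _ _ _; rewrite raddf_insert.
Qed.

End Derivations.

(** * Translation of the indexed sums in the definitions *)

Lemma exchange_triangle (W : nmodType) n (F : nat -> nat -> W) :
  \sum_(k < n.+1) \sum_(i < (n - k).+1) F i k =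
  \sum_(i < n.+1) \sum_(k < (n - i).+1) F i k.
Proof.
have widen (H : nat -> nat -> W) : \sum_(k < n.+1) \sum_(i < (n - k).+1) H k i =
    \sum_(k < n.+1) \sum_(i < n.+1 | (i < (n - k).+1)%N) H k i.
  by apply: eq_bigr => k _; rewrite (big_ord_widen n.+1)// ltnS leq_subr.
rewrite (widen (fun k i => F i k)) (widen F).
rewrite (exchange_big_dep xpredT)//=; apply: eq_bigr => i _.
by apply: eq_bigl => k; have := ltn_ord i; have := ltn_ord k; lia.
Qed.

Section Conversions.
Variables (R : realType) (G : set (R * int)) (rank : R * int -> nat).
Hypothesis rG : ranked G rank.
Variables (V : lmodType R) (C : int -> set V).
Implicit Types (p f : operations V).

Lemma fsum_splittings (W : nmodType) b (F : R * int -> R * int -> W) :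
  \sum_(c \in splittings G b) F c.1 c.2 = bsum G b F.
Proof. by rewrite fsbig_finite//=; apply: (ranked_splits rG). Qed.

Lemma homogeneous_cons j d v x :
  homogeneous C (j :: d) (v :: x) <-> C j v /\ homogeneous C d x.
Proof.
split=> [[[sz] h]|[Cv [sz h]]]; last by split=> [|[|i]]//=; [rewrite sz | apply: h].
by split; [apply: (h 0%N) | split=> // i; apply: (h i.+1)].
Qed.

Lemma homogeneous_cat d1 d2 x1 x2 :
  homogeneous C d1 x1 -> homogeneous C d2 x2 -> homogeneous C (d1 ++ d2) (x1 ++ x2).
Proof.
elim: x1 d1 => [|v x1 IHx] [|j d1] //=; try by move=> [].
move=> /homogeneous_cons[Cv h1] h2; apply/homogeneous_cons; split=> //.
exact: IHx.
Qed.

Lemma homogeneous_catP d a b : homogeneous C d (a ++ b) ->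
  exists d1 d2, [/\ d = d1 ++ d2, homogeneous C d1 a & homogeneous C d2 b].
Proof.
elim: a d => [|v a IHa] d /=; first by exists [::], d.
case: d => [[]//|j d] /homogeneous_cons[Cv /IHa[d1 [d2 [-> h1 h2]]]].
by exists (j :: d1), d2; split=> //; apply/homogeneous_cons.
Qed.

Lemma sdeg_cons j d : sdeg (j :: d) = j - 1 + sdeg d.
Proof. by rewrite /sdeg big_cons. Qed.

Lemma sdeg_cat d1 d2 : sdeg (d1 ++ d2) = sdeg d1 + sdeg d2.
Proof. by rewrite /sdeg big_cat. Qed.

Section Signs.
Variables (eps : int) (sg : V -> V).
Hypothesis sgE : forall j v, C j v -> sg v = (-1) ^ (eps * (j - 1)) *: v.

(** Each letter contributes its own sign, and the exponents add up to the shifted degree of the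
    word: this is the Koszul sign. *)
Lemma multilin_signs (p : seq V -> V) d a z : multilin p -> homogeneous C d a ->
  p (map sg a ++ z) = (-1) ^ (eps * sdeg d) *: p (a ++ z).
Proof.
elim: a d p => [|v a IHa] [|j d] p pl /=; try by move=> [].
  by rewrite /sdeg big_nil mulr0 expr0z scale1r.
move=> /homogeneous_cons[Cv ha]; rewrite (sgE Cv).
rewrite (linearZP _ _ (pl [::] (map sg a ++ z))) /=.
rewrite (IHa d _ (multilin_cons v pl) ha).
by rewrite scalerA -exprzDr ?unitrN1 ?unitr1 // -mulrDr -sdeg_cons.
Qed.

(** On a homogeneous word the sign in [insertions] is the effect of [sg] on the letters to the left
    of the inserted block. What remains is to sum over the position before the length of the
    block. *)
Lemma insertions_ins p (q : operations V) b d x : (forall b, multilin (p b)) ->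
  homogeneous C d x -> insertions G eps p q b d x = ins G sg p q b x.
Proof.
move=> pl hx.
pose F i k := bsum G b (fun b1 b2 =>
  p b1 (map sg (take i x) ++ q b2 (take k (drop i x)) :: drop k (drop i x))).
transitivity (\sum_(k < (size x).+1) \sum_(i < (size x - k).+1) F i k).
  apply: eq_bigr => k _; apply: eq_bigr => i _.
  rewrite (fsum_splittings b (fun b1 b2 => (-1) ^ (eps * sdeg (take i d)) *:
    p b1 (take i x ++ q b2 (take k (drop i x)) :: drop (i + k) x))).
  apply: (eq_bsum rG) => b1 b2 _ _ _; rewrite drop_drop.
  have [d1 [d2 [dE h1 h2]]] : exists d1 d2, [/\ d = d1 ++ d2,
      homogeneous C d1 (take i x) & homogeneous C d2 (drop i x)].
    by apply: homogeneous_catP; rewrite cat_take_drop.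
  have -> : take i d = d1.
    rewrite dE take_size_cat//; have [-> _] := h1; rewrite size_takel//.
    by move: (ltn_ord i); rewrite ltnS => /leq_trans -> //; apply: leq_subr.
  rewrite (multilin_signs _ _ h1); last exact: pl.
  by rewrite addnC.
rewrite exchange_triangle /F /ins.
rewrite (eq_bigr (fun i : 'I__ => bsum G b (fun b1 b2 =>
  cutsum (fun y z => p b1 (map sg (take i x) ++ q b2 y :: z)) (drop i x)))).
  rewrite /bsum exchange_big/=; apply: eq_bigr => c _.
  by rewrite /insert cutsumE.
move=> i _; rewrite /bsum exchange_big/=; apply: eq_bigr => c _.
by rewrite cutsumE size_drop.
Qed.

End Signs.

Definition term p f (q : (R * int) * seq (nat * (R * int))) (x : seq V) : V :=
  p q.1 [seq f r.1 r.2 | r <- zip (unzip2 q.2) (reshape (unzip1 q.2) x)].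

(** The decompositions with exactly [l] parts, listed along the recursion of [blocks] so that the
    two match summand by summand. *)
Fixpoint decs (l : nat) (b : R * int) (k : nat) :
    seq ((R * int) * seq (nat * (R * int))) :=
  if l is l'.+1 then
    [seq (q.1, (e.2, e.1.1) :: q.2) |
      e <- [seq (c, k1) | c <- splits G b, k1 <- index_iota 0 k.+1],
      q <- decs l' e.1.2 (k - e.2)]
  else if k == 0%N then [:: (b, [::])] else [::].

Lemma blocks_decs l p f b x :
  blocks G l p f b x = \sum_(q <- decs l b (size x)) term p f q x.
Proof.
elim: l p b x => [|l IHl] p b x.
  by case: x => [|? ?] /=; rewrite ?big_nil// big_seq1.
rewrite [decs _ _ _]/(allpairs_dep _ _ _) big_allpairs_dep big_allpairs_dep.
apply: eq_bigr => c _; rewrite cutsumE big_mkord.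
by apply: eq_bigr => k _; rewrite -(size_drop k x); apply: IHl.
Qed.

Lemma mem_decsS l b k q : reflect
    (exists b1 b2 k1 b0 s, [/\ [/\ G b1, G b2 & b1 + b2 = b], (k1 <= k)%N,
       (b0, s) \in decs l b2 (k - k1) & q = (b0, (k1, b1) :: s)])
  (q \in decs l.+1 b k).
Proof.
apply: (iffP allpairsPdep).
  move=> [_ [[b0 s] [/allpairsP[[[b1 b2] k1] [/(splitsP rG) cb + ->]] /=]]].
  rewrite mem_index_iota ltnS => k1k qs ->.
  by exists b1, b2, k1, b0, s.
move=> [b1 [b2 [k1 [b0 [s [gb k1k qs ->]]]]]].
exists ((b1, b2), k1), (b0, s); split=> //.
apply/allpairsP; exists ((b1, b2), k1); split=> //; first exact/(splitsP rG).
by rewrite mem_index_iota ltnS.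
Qed.

Lemma G_sum b0 (s : seq (nat * (R * int))) : G b0 ->
  (forall r, r \in s -> G r.2) -> G (b0 + \sum_(r <- s) r.2).
Proof.
elim: s b0 => [|r s IHs] b0 g0 gs; first by rewrite big_nil addr0.
rewrite big_cons addrA; apply: IHs => [|r' rs]; last by apply: gs; rewrite inE rs orbT.
by apply: (rankedD rG) => //; apply: gs; rewrite inE eqxx.
Qed.

Lemma decsP l b k q : G b ->
  reflect (decompositions G b k q /\ size q.2 = l) (q \in decs l b k).
Proof.
move=> gb; apply: (iffP idP).
  elim: l b k q gb => [|l IHl] b k q gb.
    rewrite /=; case: eqP => // ->; rewrite inE => /eqP -> /=.
    by split=> //; split=> //=; rewrite big_nil addr0.
  move=> /mem_decsS[b1 [b2 [k1 [b0 [s [[g1 g2 bE] k1k + ->]]]]]].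
  move=> /(IHl _ _ _ g2)[[/= gq1 gq2 qE kE] <-]; split=> //; split=> //=.
  - by move=> r; rewrite inE => /predU1P[->//|/gq2].
  - by rewrite big_cons /= addrCA qE.
  - by rewrite kE subnKC.
elim: l b k q gb => [|l IHl] b k [b0 [|[k1 b1] s]] gb [[/= g0 gs bE kE] sz]//.
  by rewrite /= -kE /= inE -bE big_nil addr0.
have gs' : forall r, r \in s -> G r.2.
  by move=> r rs; apply: gs; rewrite inE rs orbT.
have gS := G_sum g0 gs'.
apply/mem_decsS; exists b1, (b0 + \sum_(r <- s) r.2), k1, b0, s; split=> //.
- split=> //; first by apply: (gs (k1, b1)); rewrite inE eqxx.
  by rewrite -bE big_cons addrCA.
- by rewrite -kE leq_addr.
apply: IHl => //=; split; last by case: sz.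
by split=> //=; rewrite -kE addKn.
Qed.

Lemma decs_uniq l b k : uniq (decs l b k).
Proof.
elim: l b k => [|l IHl] b k; first by rewrite /=; case: eqP.
apply: allpairs_uniq_dep => [|e|].
- by apply: allpairs_uniq; rewrite ?splits_uniq ?iota_uniq// => -[? ?] [? ?] _ _ [-> ->].
- by move=> _; apply: IHl.
move=> p1 p2 /allpairsPdep[e1 [q1 [e1P _ ->]]] /allpairsPdep[e2 [q2 [e2P _ ->]]] /=.
move: e1P e2P => /allpairsPdep[[c1 c1'] [k1 [/(splitsP rG)[_ _ E1] _ ->]]].
move=> /allpairsPdep[[c2 c2'] [k2 [/(splitsP rG)/= [_ _ E2] _ ->]]] /=.
case: q1 q2 => [q1 q1'] [q2 q2'] [/= -> -> c12 ->].
by move: E1; rewrite -E2 c12 => /addrI /= ->.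
Qed.

(** A part other than (0, 0) uses up a letter or raises the rank, so rank plus length bounds the
    number of parts. *)
Lemma size_parts b0 (s : seq (nat * (R * int))) : G b0 ->
  (forall r, r \in s -> G r.2 /\ r != (0%N, 0)) ->
  G (b0 + \sum_(r <- s) r.2)%R /\
  (size s <= rank (b0 + \sum_(r <- s) r.2)%R + sumn (unzip1 s))%N.
Proof.
move=> g0; elim: s => [|[k1 b1] s IHs] gs /=; first by rewrite big_nil addr0.
have [r rs|gS szS] := IHs; first by apply: gs; rewrite inE rs orbT.
have [g1 ne] : G b1 /\ (k1, b1) != (0%N, 0) by apply: (gs (k1, b1)); rewrite inE eqxx.
rewrite big_cons addrCA addrC; split; first exact: (rankedD rG).
have [b10|b10] := eqVneq b1 0.
  move: ne; rewrite b10 addr0 xpair_eqE eqxx andbT => k1n0.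
  case: k1 k1n0 {gs} => // k1 _; rewrite addSn addnS ltnS.
  by apply: leq_trans szS _; rewrite leq_add2l leq_addl.
apply: leq_ltn_trans szS _; rewrite addnA ltn_add2r ltn_addr//.
exact: (ranked_lt rG gS g1 b10).
Qed.

Lemma term0 p f b0 s x : multilin (p b0) -> f 0 [::] = 0 ->
  (0%N, 0) \in s -> term p f (b0, s) x = 0.
Proof.
rewrite /term /=; move: (p b0) => {}p + f0.
elim: s p x => [//|[k1 b1] s IHs] p x pl; rewrite inE => /predU1P[[<- <-]|in_s] /=.
  by rewrite take0 f0 (linear0P (pl [::] _)).
by apply: (IHs (fun y => p (_ :: y))) => //; apply: multilin_cons.
Qed.

(** A decomposition with [L] or more parts contains a part (0, 0), where [f] vanishes. The bound [L]
    is left free so that one value can serve for several words and labels at once. *)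
Lemma compose_blocks p f b x L : G b -> (forall b, multilin (p b)) ->
  f 0 [::] = 0 -> (rank b + size x < L)%N ->
  compose G p f b x = \sum_(l < L) blocks G l p f b x.
Proof.
move=> gb pl f0 bxL.
pose D := flatten [seq decs l b (size x) | l <- iota 0 L].
have DP q : reflect (decompositions G b (size x) q /\ (size q.2 < L)%N) (q \in D).
  apply: (iffP flatten_mapP) => [[l]|[dq ql]].
    by rewrite mem_iota => /= lL /(decsP _ _ _ gb)[dq ->].
  by exists (size q.2); [rewrite mem_iota | apply/decsP].
have uD : uniq D.
  rewrite /D; elim: L {bxL D DP} 0%N => [//|L IHL] l0 /=.
  rewrite cat_uniq decs_uniq// IHL andbT; apply/hasPn => q /flatten_mapP[l + /decsP].
  rewrite mem_iota => ll /(_ gb)[_ ql]; apply/negP => /(decsP _ _ _ gb)[_ ql'].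
  by move: ll; rewrite -ql ql' ltnn.
transitivity (\sum_(q <- D) term p f q x); last first.
  rewrite /D big_flatten big_map -(big_mkord xpredT (fun l => blocks G l p f b x)).
  by rewrite /index_iota subn0; apply: eq_bigr => l _; rewrite blocks_decs.
rewrite fsbig_seq// /compose; apply/esym; apply: fsbig_widen => [q|q].
  by move=> /DP[].
move=> [/= dq qD]; have [g0 gs bE kE] := dq.
have [in_s|nin_s] := boolP ((0%N, 0) \in q.2).
  by case: q {dq qD g0 gs bE kE} in_s => b0 s /= in_s; apply: term0.
exfalso; apply: qD; apply/DP; split=> //.
have [r rs|_] := @size_parts q.1 q.2 g0; first split; first exact: gs.
  by apply: contraNneq nin_s => <-.
by rewrite bE kE => h; apply: leq_ltn_trans bxL.
Qed.

End Conversions.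

(** * Derivatives on the unit interval *)

Section Derivative01.
Variable R : realType.
Implicit Types (a b : R -> R) (t l : R).

Definition continuous01 a : Prop :=
  forall t, t \in `[0, 1] -> a s @[s --> within `[0, 1] t^'] --> a t.

#[local] Instance within01_filter t : Filter (within `[(0 : R), 1] t^').
Proof. exact: within_filter. Qed.

Lemma near01P t (P : R -> Prop) :
  (\forall s \near within `[0, 1] t^', P s) <->
  exists2 d, 0 < d & forall s, s \in `[0, 1] -> `|s - t| < d -> s != t -> P s.
Proof.
rewrite /within /dnbhs /=; split.
  move=> /nbhs_ballP[d /= d0 dP]; exists d => // s s01 sd st.
  by apply: dP => //; rewrite /ball /= distrC.
move=> [d d0 dP]; apply/nbhs_ballP; exists d => // s /=.
by rewrite /ball /= distrC => sd st s01; apply: dP.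
Qed.

Lemma eq_derivative01 a b t l : t \in `[0, 1] -> {in `[0, 1], a =1 b} ->
  derivative01 a t l -> derivative01 b t l.
Proof.
move=> t01 ab; apply: cvg_trans; apply: near_eq_cvg.
by apply/near01P; exists 1 => // s s01 _ _; rewrite !ab.
Qed.

Lemma derivative01_cst k t : derivative01 (fun=> k) t 0.
Proof.
rewrite /derivative01; under eq_fun do rewrite subrr mul0r.
exact: cvg_cst.
Qed.

Lemma derivative01D a b t k l : derivative01 a t k -> derivative01 b t l ->
  derivative01 (fun s => a s + b s) t (k + l).
Proof.
rewrite /derivative01 => da db; have := @cvgD _ _ _ _ (within01_filter t) _ _ _ _ da db; apply: cvg_trans; apply: near_eq_cvg.
by apply/near01P; exists 1 => // s _ _ _ /=; rewrite -mulrDl opprD addrACA.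
Qed.

Lemma derivative01_continuous a t l : derivative01 a t l ->
  a s @[s --> within `[0, 1] t^'] --> a t.
Proof.
rewrite /derivative01 => da.
have cid : (s - t) @[s --> within `[0, 1] t^'] --> (0 : R).
  apply/cvgrPdist_lt => e e0; apply/near01P; exists e => // s _ sd _.
  by rewrite sub0r normrN.
have FF := within01_filter t.
have := @cvgD _ _ _ _ FF _ _ _ _ (@cvgM _ _ _ FF _ _ _ _ da cid) (@cvg_cst _ (a t) _ _ FF).
rewrite mulr0 add0r; apply: cvg_trans; apply: near_eq_cvg.
apply/near01P; exists 1 => // s _ _ st /=.
by rewrite fctE /= divfK ?subr_eq0// subrK.
Qed.

Lemma derivative01M a b t k l : derivative01 a t k -> derivative01 b t l ->
  derivative01 (fun s => a s * b s) t (k * b t + a t * l).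
Proof.
move=> da db.
have ca := derivative01_continuous da.
move: da db; rewrite /derivative01 => da db.
have FF := within01_filter t.
have := @cvgD _ _ _ _ FF _ _ _ _ (@cvgM _ _ _ FF _ _ _ _ da (@cvg_cst _ (b t) _ _ FF))
  (@cvgM _ _ _ FF _ _ _ _ ca db).
apply: cvg_trans; apply: near_eq_cvg.
apply/near01P; exists 1 => // s _ _ _ /=; rewrite !fctE /=.
by rewrite mulrAC mulrA -mulrDl mulrBl mulrBr addrC addrA subrK.
Qed.

(** Form without division, which allows [s = t] and therefore survives precomposition with
    [clamp]. *)
Lemma derivative01P a t l : derivative01 a t l <->
  forall e, 0 < e -> exists2 d, 0 < d & forall s, s \in `[0, 1] ->
    `|s - t| < d -> `|a s - a t - l * (s - t)| <= e * `|s - t|.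
Proof.
split=> [/cvgrPdist_lt da e e0|da].
  have /near01P[d d0 dP] := da e e0; exists d => // s s01 sd.
  have [->|st] := eqVneq s t; first by rewrite !subrr mulr0 subrr normr0 mulr0.
  have st0 : s - t != 0 by rewrite subr_eq0.
  rewrite -[X in `|X - _|](divfK st0) -mulrBl normrM ler_wpM2r// distrC.
  exact/ltW/dP.
apply/cvgrPdist_le => e e0; have [d d0 dP] := da e e0.
apply/near01P; exists d => // s s01 sd st.
have st0 : s - t != 0 by rewrite subr_eq0.
rewrite distrC -(ler_pM2r (_ : 0 < `|s - t|)) ?normr_gt0// -normrM mulrBl divfK//.
exact: dP.
Qed.

(** The 1-Lipschitz retraction of the line onto the unit interval. It extends functions known only
    there, so that calculus on the line applies. *)
Definition clamp (s : R) : R := Num.max 0 (Num.min 1 s).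

Lemma clamp01 s : clamp s \in `[0, 1].
Proof.
rewrite in_itv/= /clamp; case: (leP 1 s) => ?.
  by case: (leP (0 : R) 1) => ?; apply/andP; split; lra.
by case: (leP 0 s) => ?; apply/andP; split; lra.
Qed.

Lemma clamp_id s : s \in `[0, 1] -> clamp s = s.
Proof.
rewrite in_itv/= /clamp => /andP[? ?].
by case: (leP 1 s) => ?; case: (ltP 0 _) => ?; lra.
Qed.

Lemma clamp_lip s t : `|clamp s - clamp t| <= `|s - t|.
Proof.
have h1 := ler_norm (s - t); have h2 := ler_norm (t - s); rewrite distrC in h2.
have h0 := normr_ge0 (s - t); rewrite /clamp ler_norml.
case: (leP 1 s) => ?; case: (leP 1 t) => ?; case: (leP (0 : R) 1) => ?;
  case: (leP 0 s) => ?; case: (leP 0 t) => ?; apply/andP; split; lra.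
Qed.

(** Because [clamp] is 1-Lipschitz, the function composed with it has derivative zero on the whole
    line, end points included, and the result for the line applies. *)
Lemma derivative01_0_cst a : (forall t, t \in `[0, 1] -> derivative01 a t 0) ->
  {in `[0, 1] &, forall s t, a s = a t}.
Proof.
move=> da s t s01 t01; rewrite -(clamp_id s01) -(clamp_id t01).
apply: (@is_derive_0_is_cst _ (a \o clamp)) => {s01 t01} {}t.
have cvg0 : h^-1 *: ((a \o clamp \o shift t) (h *: 1) - a (clamp t)) @[h --> 0^'] --> (0 : R).
  apply/cvgrPdist_le => e e0.
  have [d d0 dP] := (derivative01P _ _ _).1 (da _ (clamp01 t)) e e0.
  rewrite /dnbhs near_withinE; apply/nbhs_ballP; exists d => // h.
  rewrite /ball /= sub0r normrN => hd h0.
  have ht : `|clamp (h + t) - clamp t| <= `|h|.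
    by apply: le_trans (clamp_lip _ _) _; rewrite addrK.
  rewrite sub0r normrN normrM normfV ler_pdivrMl ?normr_gt0// mulrC.
  rewrite [_ *: 1]mulr1.
  have := dP _ (clamp01 (h + t)) (le_lt_trans ht hd).
  rewrite mul0r subr0 => /le_trans; apply.
  by rewrite ler_wpM2l// ltW.
split; first by apply/cvg_ex; exists 0.
exact: cvg_lim cvg0.
Qed.

Lemma antiderivative01 a tau : continuous01 a -> tau \in `[0, 1] ->
  exists2 A : R -> R, A tau = 0 & forall t, t \in `[0, 1] -> derivative01 A t (a t).
Proof.
move=> ca tau01.
have cac : continuous (a \o clamp).
  move=> t; apply/cvgrPdist_lt => e e0.
  have /cvgrPdist_lt/(_ e e0)/near01P[d d0 dP] := ca _ (clamp01 t).
  apply/nbhs_ballP; exists d => // s; rewrite /ball /= distrC => st.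
  have [->|ne] := eqVneq (clamp s) (clamp t); first by rewrite subrr normr0.
  by apply: dP ne; [exact: clamp01 | exact: le_lt_trans (clamp_lip _ _) st].
(* The interval from -1 to 2 has the unit interval in its interior, so the fundamental theorem holds
   at 0 and 1 as well. *)
pose F x := (\int[lebesgue_measure]_(s in [set` `[(-1 : R), x]]) (a (clamp s)))%R.
have dF t : t \in `[0, 1] -> derivable F t 1 /\ derive1 F t = a (clamp t).
  move=> t01; apply: (@continuous_FTC1_closed _ (a \o clamp) (-1) t 2).
  - by move: t01; rewrite in_itv/=; lra.
  - apply: continuous_compact_integrable; first exact: segment_compact.
    exact: continuous_subspaceT.
  - by move: t01; rewrite in_itv/=; lra.
  - exact: cac.
exists (fun s => F s - F tau); first by rewrite subrr.
move=> t t01; have [Fd FE] := dF t t01.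
rewrite -[a t]addr0; apply: derivative01D (derivative01_cst _ _).
rewrite -(clamp_id t01) -FE derive1E clamp_id//.
have /cvgrPdist_le cF := Fd : h^-1 *: ((F \o shift t) (h *: 1) - F t) @[h --> 0^'] --> 'D_1 F t.
apply/derivative01P => e e0; have := cF e e0.
rewrite /dnbhs near_withinE => /nbhs_ballP[d /= d0 dP]; exists d => // s _ sd.
have [->|st] := eqVneq s t; first by rewrite !subrr mulr0 subrr normr0 mulr0.
have st0 : s - t != 0 by rewrite subr_eq0.
have := dP (s - t); rewrite /ball /= sub0r normrN => /(_ sd st0).
rewrite [_ *: 1]mulr1 subrK => /(ler_wpM2r (normr_ge0 (s - t))).
by rewrite -normrM mulrBl distrC [_^-1 *: _]mulrC divfK.
Qed.

End Derivative01.

(** * Differentiable curves in a vector space without topology *)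

(* Curves in W that are finite sums of scalar functions times fixed vectors, on
   [0,1]; nothing is required of the curves elsewhere. *)
Inductive has_derivative (R : realType) (W : lmodType R) (t : R) :
    (R -> W) -> W -> Prop :=
| has_derivative0 phi : {in `[0, 1], phi =1 fun=> 0} -> has_derivative t phi 0
| has_derivative_cons a l v phi w psi :
    derivative01 a t l -> has_derivative t phi w ->
    {in `[0, 1], forall s, psi s = a s *: v + phi s} ->
    has_derivative t psi (l *: v + w).

Inductive continuous_curve (R : realType) (W : lmodType R) :
    (R -> W) -> Prop :=
| continuous_curve0 phi : {in `[0, 1], phi =1 fun=> 0} -> continuous_curve phi
| continuous_curve_cons a v phi psi :
    continuous01 a -> continuous_curve phi ->
    {in `[0, 1], forall s, psi s = a s *: v + phi s} -> continuous_curve psi.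

Lemma fsum_linear (R : realType) (W : lmodType R) (I : choiceType) (P : set I)
    (a : R) (f g : I -> W) :
  finite_set [set i | f i != 0] -> finite_set [set i | g i != 0] ->
  \sum_(i \in P) (a *: f i + g i) = a *: (\sum_(i \in P) f i) + \sum_(i \in P) g i.
Proof.
move=> ff fg; pose S := [set i | f i != 0] `|` [set i | g i != 0].
have fS : finite_set S by rewrite finite_setU.
have sumE (h : I -> W) : [set i | h i != 0] `<=` S ->
    \sum_(i \in P) h i = \sum_(i <- finmap.enum_fset (fset_set (P `&` S))) h i.
  move=> hS; rewrite -fsbig_finite//=; last exact: finite_setIr.
  apply/esym/fsbig_widen => [i []//|i [Pi nS] /=].
  have [//|h0] := eqVneq (h i) 0.
  by exfalso; apply: nS; split=> //; apply: hS.
rewrite !sumE; first last.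
- by move=> i; left.
- by move=> i; right.
- move=> i /=; have [f0|f0 _] := eqVneq (f i) 0; last by left.
  by rewrite f0 scaler0 add0r; right.
by rewrite scaler_sumr -big_split.
Qed.

Section Curves.
Variables (R : realType).
Implicit Types (W : lmodType R) (t : R).

Lemma eq_has_derivative W t (phi psi : R -> W) w w' :
  {in `[0, 1], phi =1 psi} -> w = w' ->
  has_derivative t phi w -> has_derivative t psi w'.
Proof.
move=> e <- h; case: h e => [{}phi phi0|a l v chi {}w {}phi da dchi phiE] e.
  by apply: has_derivative0 => s s01; rewrite -e// phi0.
by apply: (has_derivative_cons da dchi) => s s01; rewrite -e// phiE.
Qed.

Lemma eq_continuous_curve W (phi psi : R -> W) :
  {in `[0, 1], phi =1 psi} -> continuous_curve phi -> continuous_curve psi.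
Proof.
move=> e h; case: h e => [{}phi phi0|a v chi {}phi ca cchi phiE] e.
  by apply: continuous_curve0 => s s01; rewrite -e// phi0.
by apply: (continuous_curve_cons ca cchi) => s s01; rewrite -e// phiE.
Qed.

Lemma has_derivativeD W t (phi psi : R -> W) v w :
  has_derivative t phi v -> has_derivative t psi w ->
  has_derivative t (fun s => phi s + psi s) (v + w).
Proof.
move=> h hpsi; elim: h => {phi v} [phi phi0|a l u chi v phi da _ IH phiE].
  by apply: eq_has_derivative hpsi; rewrite ?add0r// => s /phi0 ->; rewrite add0r.
rewrite -addrA; apply: (has_derivative_cons da IH) => s s01.
by rewrite phiE// addrA.
Qed.

Lemma continuous_curveD W (phi psi : R -> W) :
  continuous_curve phi -> continuous_curve psi ->
  continuous_curve (fun s => phi s + psi s).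
Proof.
move=> h hpsi; elim: h => {phi} [phi phi0|a u chi phi ca _ IH phiE].
  by apply: eq_continuous_curve hpsi => s /phi0 ->; rewrite add0r.
by apply: (continuous_curve_cons ca IH) => s s01; rewrite phiE// addrA.
Qed.

Lemma has_derivative_smul W t a l (phi : R -> W) w :
  t \in `[0, 1] -> derivative01 a t l -> has_derivative t phi w ->
  has_derivative t (fun s => a s *: phi s) (l *: phi t + a t *: w).
Proof.
move=> t01 da; elim=> {phi w} [phi phi0|b k v chi w phi db _ IH phiE].
  rewrite phi0// !scaler0 addr0.
  by apply: has_derivative0 => s /phi0 ->; rewrite scaler0.
have E : {in `[0, 1], forall s, a s *: phi s = (a s * b s) *: v + a s *: chi s}.
  by move=> s s01; rewrite phiE// scalerDr scalerA.
apply: eq_has_derivative (has_derivative_cons (derivative01M da db) IH E) => //.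
by rewrite phiE// !scalerDr !scalerA addrACA -scalerDl.
Qed.

Lemma continuous_curve_smul W a (phi : R -> W) :
  continuous01 a -> continuous_curve phi ->
  continuous_curve (fun s => a s *: phi s).
Proof.
move=> ca; elim=> {phi} [phi phi0|b v chi phi cb _ IH phiE].
  by apply: continuous_curve0 => s /phi0 ->; rewrite scaler0.
have cab : continuous01 (fun s => a s * b s).
  by move=> t t01; apply: (@cvgM _ _ _ (within01_filter t)); [apply: ca | apply: cb].
by apply: (continuous_curve_cons cab IH) => s s01; rewrite phiE// scalerDr scalerA.
Qed.

Lemma has_derivative_cst W t (v : W) : has_derivative t (fun=> v) 0.
Proof.
rewrite -[0](addr0 (0 : W)) -[X in X + _](scale0r v).
apply: (has_derivative_cons (derivative01_cst 1 t) (has_derivative0 t _)) => //.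
by move=> s _; rewrite scale1r addr0.
Qed.

Lemma continuous_curve_cst W (v : W) : continuous_curve (fun=> v).
Proof.
have c1 : continuous01 (fun=> 1 : R) by move=> t _; apply: cvg_cst.
apply: (continuous_curve_cons c1 (continuous_curve0 (phi := fun=> 0) _)) => //.
by move=> s _; rewrite scale1r addr0.
Qed.

Lemma has_derivative_sum W t (I : eqType) (r : seq I) (F : I -> R -> W) F' :
  (forall i, i \in r -> has_derivative t (F i) (F' i)) ->
  has_derivative t (fun s => \sum_(i <- r) F i s) (\sum_(i <- r) F' i).
Proof.
elim: r => [|i r IHr] dF.
  by rewrite big_nil; apply: has_derivative0 => s _; rewrite big_nil.
have {}IHr := IHr (fun k kr => dF k (mem_behead (s := i :: r) kr)).
rewrite big_cons; apply: eq_has_derivative (has_derivativeD (dF i _) IHr) => //.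
  by move=> s _; rewrite big_cons.
by rewrite inE eqxx.
Qed.

Lemma continuous_curve_sum W I (r : seq I) (F : I -> R -> W) :
  (forall i, continuous_curve (F i)) ->
  continuous_curve (fun s => \sum_(i <- r) F i s).
Proof.
move=> dF; elim: r => [|i r IHr].
  by apply: continuous_curve0 => s _; rewrite big_nil.
apply: eq_continuous_curve (continuous_curveD (dF i) IHr) => //.
by move=> s _; rewrite big_cons.
Qed.

Lemma has_derivative_cutsum W t T (F : R -> seq T -> seq T -> W) F' x :
  (forall a b, has_derivative t (fun s => F s a b) (F' a b)) ->
  has_derivative t (fun s => cutsum (F s) x) (cutsum F' x).
Proof.
move=> dF; rewrite cutsumE.
have := has_derivative_sum (r := index_enum 'I_(size x).+1)
  (fun (k : 'I__) _ => dF (take k x) (drop k x)).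
by apply: eq_has_derivative => // s _; rewrite cutsumE.
Qed.

Lemma continuous_curve_cutsum W T (F : R -> seq T -> seq T -> W) x :
  (forall a b, continuous_curve (fun s => F s a b)) ->
  continuous_curve (fun s => cutsum (F s) x).
Proof.
move=> dF; have := continuous_curve_sum (index_enum 'I_(size x).+1)
  (fun k : 'I__ => dF (take k x) (drop k x)).
by apply: eq_continuous_curve => // s _; rewrite cutsumE.
Qed.

(** Writing [phi] as a finite sum of scalar functions times fixed vectors reduces this product rule
    to the scalar one; [F] has to be differentiable only on each fixed vector. *)
Lemma has_derivative_apply W W' t (F : R -> W -> W') F' (phi : R -> W) w :
  t \in `[0, 1] -> (forall s, linear (F s)) -> linear F' ->
  (forall v, has_derivative t (fun s => F s v) (F' v)) ->
  has_derivative t phi w ->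
  has_derivative t (fun s => F s (phi s)) (F' (phi t) + F t w).
Proof.
move=> t01 Fl F'l dF; elim=> {phi w} [phi phi0|a l v chi w phi da _ IH phiE].
  rewrite phi0// (linear0P F'l) (linear0P (Fl t)) addr0.
  by apply: has_derivative0 => s /phi0 ->; rewrite (linear0P (Fl s)).
have := has_derivativeD (has_derivative_smul t01 da (dF v)) IH.
apply: eq_has_derivative => [s s01|]; first by rewrite phiE// Fl.
by rewrite phiE// F'l Fl addrACA [l *: _ + _]addrC addrACA.
Qed.

Lemma continuous_curve_apply W W' (F : R -> W -> W') (phi : R -> W) :
  (forall s, linear (F s)) -> (forall v, continuous_curve (F^~ v)) ->
  continuous_curve phi -> continuous_curve (fun s => F s (phi s)).
Proof.
move=> Fl cF; elim=> {phi} [phi phi0|a v chi phi ca _ IH phiE].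
  by apply: continuous_curve0 => s /phi0 ->; rewrite (linear0P (Fl s)).
have := continuous_curveD (continuous_curve_smul ca (cF v)) IH.
by apply: eq_continuous_curve => s s01; rewrite phiE// Fl.
Qed.

Lemma has_derivative_linear W W' t (h : W -> W') (phi : R -> W) w :
  t \in `[0, 1] -> linear h -> has_derivative t phi w ->
  has_derivative t (fun s => h (phi s)) (h w).
Proof.
move=> t01 hl dphi.
have l0 : linear ((fun=> 0) : W -> W') by move=> a u v; rewrite scaler0 addr0.
have := has_derivative_apply t01 (fun=> hl) l0 _ dphi.
by rewrite add0r => H; apply: H => v; apply: has_derivative_cst.
Qed.

(** Linear forms separate points. A form carries a curve with zero derivative to a constant real
    function, so under this condition the curve itself is constant. *)
Definition enough_functionals W : Prop :=
  forall w : W, (forall h : W -> R^o, linear h -> h w = 0) -> w = 0.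

Lemma has_derivative_scalar W t (h : W -> R^o) (phi : R -> W) w :
  t \in `[0, 1] -> linear h -> has_derivative t phi w ->
  derivative01 (fun s => h (phi s)) t (h w).
Proof.
move=> t01 hl; elim=> {phi w} [phi phi0|a l v chi w phi da _ IH phiE].
  rewrite (linear0P hl); apply: eq_derivative01 (derivative01_cst 0 t) => //.
  by move=> s /phi0 ->; rewrite (linear0P hl).
rewrite hl; have -> : l *: h v = l * h v + a t * 0 by rewrite mulr0 addr0.
have := derivative01D (derivative01M da (derivative01_cst (h v) t)) IH.
by apply: eq_derivative01 => // s s01; rewrite phiE// hl.
Qed.

Lemma has_derivative0_cst W (phi : R -> W) : enough_functionals W ->
  (forall t, t \in `[0, 1] -> has_derivative t phi 0) ->
  {in `[0, 1] &, forall s t, phi s = phi t}.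
Proof.
move=> sepW dphi s t s01 t01; apply/eqP; rewrite -subr_eq0; apply/eqP.
apply: sepW => h hl.
rewrite -scaleN1r addrC hl scaleN1r addrC; apply/eqP; rewrite subr_eq0; apply/eqP.
apply: (@derivative01_0_cst _ (fun s => h (phi s))) => // u u01.
by rewrite -(linear0P hl); apply: has_derivative_scalar => //; apply: dphi.
Qed.

Lemma enough_functionals_regular : enough_functionals R^o.
Proof. by move=> w /(_ id); apply. Qed.

(** The coordinates with respect to [B] are linear by uniqueness of expansions, and only 0 has all
    of them zero. *)
Lemma enough_functionals_basis W (B : set W) : is_basis B -> enough_functionals W.
Proof.
move=> basisB w w0.
have coordP v := cid (basisB v).
pose coord e v := sval (coordP v) e.
have coord_spec v : [/\ [set e | coord e v != 0] `<=` B,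
    finite_set [set e | coord e v != 0] & v = \sum_(e \in B) coord e v *: e].
  by have [] := svalP (coordP v).
have coord_uniq v a : [/\ [set e | a e != 0] `<=` B,
    finite_set [set e | a e != 0] & v = \sum_(e \in B) a e *: e] ->
    forall e, coord e v = a e.
  by move=> av e; have [_ /(_ _ av)] := svalP (coordP v) => /(congr1 (@^~ e)).
have coordl e : linear (coord e : W -> R^o).
  move=> k u v; have [uB fu uE] := coord_spec u; have [vB fv vE] := coord_spec v.
  apply: (coord_uniq _ (fun e => k * coord e u + coord e v)); split.
  - move=> e' /=; have [u0|u0 _] := eqVneq (coord e' u) 0; last exact: uB.
    by rewrite u0 mulr0 add0r; apply: vB.
  - apply: (sub_finite_set (B := [set e | coord e u != 0] `|` [set e | coord e v != 0])).
      move=> e' /=; have [u0|u0 _] := eqVneq (coord e' u) 0; last by left.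
      by rewrite u0 mulr0 add0r; right.
    by rewrite finite_setU.
  - rewrite {1}uE {1}vE -fsum_linear.
    + by apply: eq_fsbigr => e' _; rewrite scalerDl scalerA.
    + apply: sub_finite_set fu => e' /=; apply: contra => /eqP ->.
      by rewrite scale0r.
    + apply: sub_finite_set fv => e' /=; apply: contra => /eqP ->.
      by rewrite scale0r.
have [_ _ ->] := coord_spec w; apply: fsbig1 => e _.
by rewrite w0 ?scale0r.
Qed.

(** Integration is done on each coefficient. Continuity of [H] is recorded because the iteration
    below integrates again. *)
Lemma continuous_curve_antiderivative W (h : R -> W) tau :
  continuous_curve h -> tau \in `[0, 1] ->
  exists H : R -> W, [/\ H tau = 0, continuous_curve H &
    forall t, t \in `[0, 1] -> has_derivative t H (h t)].
Proof.
move=> ch tau01; elim: ch => {h} [h h0|a v chi h ca _ [H [H0 cH dH]] hE].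
  exists (fun=> 0); split=> //; first exact: continuous_curve_cst.
  by move=> t t01; rewrite h0//; apply: has_derivative_cst.
have [A A0 dA] := antiderivative01 ca tau01.
exists (fun s => A s *: v + H s); split=> [||t t01].
- by rewrite A0 H0 scale0r addr0.
- apply: (continuous_curve_cons _ cH) => // t t01.
  exact: derivative01_continuous (dA _ t01).
- by rewrite hE//; apply: (has_derivative_cons (dA _ t01) (dH _ t01)).
Qed.

Lemma smooth_curve_continuous W (phi : R -> W) :
  smooth_curve phi -> continuous_curve phi.
Proof.
move=> [s [a [[_ _ phiE] sa]]].
have ca e : e \in s -> continuous01 (a e).
  move=> /sa[D [D0 DS]] t t01; apply: (@derivative01_continuous _ _ _ (D 1%N t)).
  by apply: eq_derivative01 (DS 0%N t t01).
have {}phiE : {in `[0, 1], forall t, phi t = \sum_(e <- s) a e t *: e}.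
  exact: phiE.
elim: s phi phiE ca {sa} => [|e s IHs] phi phiE ca.
  by apply: continuous_curve0 => t /phiE ->; rewrite big_nil.
apply: (@continuous_curve_cons _ _ (a e) e (fun t => \sum_(e <- s) a e t *: e)).
- by apply: ca; rewrite inE eqxx.
- by apply: IHs => // e' e's; apply: ca; rewrite inE e's orbT.
- by move=> t /phiE ->; rewrite big_cons.
Qed.

(** The basis of an expansion may vary with the curve. It is forgotten here, so that curves expanded
    in different bases can be combined. *)
Lemma curve_has_derivative W (phi : R -> W) t v :
  curve_derivative phi t v -> has_derivative t phi v.
Proof.
move=> [s [a [l [[_ _ phiE] da ->]]]].
have {}phiE : {in `[0, 1], forall t, phi t = \sum_(e <- s) a e t *: e}.
  exact: phiE.
elim: s phi phiE da => [|e s IHs] phi phiE da.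
  by rewrite big_nil; apply: has_derivative0 => u /phiE ->; rewrite big_nil.
rewrite big_cons.
apply: (@has_derivative_cons _ _ _ (a e) _ e (fun t => \sum_(e <- s) a e t *: e)).
- by apply: da; rewrite inE eqxx.
- by apply: IHs => // e' e's; apply: da; rewrite inE e's orbT.
- by move=> u /phiE ->; rewrite big_cons.
Qed.

End Curves.

Lemma has_derivativeB (R : realType) (W : lmodType R) t (phi psi : R -> W) v w :
  t \in `[0, 1] -> has_derivative t phi v -> has_derivative t psi w ->
  has_derivative t (fun s => phi s - psi s) (v - w).
Proof.
move=> t01 dphi dpsi; apply: has_derivativeD => //.
apply: (has_derivative_linear (h := -%R)) => // a u u'.
by rewrite opprD scalerN.
Qed.

Lemma has_derivative_bsum (R : realType) (G : set (R * int)) rank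
    (W : lmodType R) t b (F : R -> R * int -> R * int -> W) F' : ranked G rank ->
  (forall b1 b2, G b1 -> G b2 -> b1 + b2 = b ->
     has_derivative t (fun s => F s b1 b2) (F' b1 b2)) ->
  has_derivative t (fun s => bsum G b (F s)) (bsum G b F').
Proof.
move=> rG dF; apply: (has_derivative_sum (F := fun k s => F s k.1 k.2)) => k.
by move=> /(splitsP rG)[]; apply: dF.
Qed.

Lemma linear_id (R : pzRingType) (V : lmodType R) : linear (id : V -> V).
Proof. by []. Qed.

Lemma multilin_identity (R : realType) (V : lmodType R) b :
  multilin (@identity R V b).
Proof.
move=> [|u [|? ?]] [|u' s2] a v w //=; try by rewrite scaler0 addr0.
by case: ifP; rewrite ?scaler0 ?addr0.
Qed.

(** * The linear equation *)

Section LinearODE.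
Variables (R : realType) (G : set (R * int)) (rank : R * int -> nat).
Hypothesis rG : ranked G rank.
Variables (V : lmodType R) (c : R -> operations V).
Hypothesis multilin_c : forall t b, multilin (c t b).
Hypothesis c0 : forall t x, c t 0 x = 0.

(** The equation d psi / dt = psi o c at the label [b]. The free target [W] puts operations and sums
    of pairings under one uniqueness statement. *)
Definition solution (W : lmodType R) (psi : R -> R * int -> seq V -> W) b :
    Prop :=
  forall t x, t \in `[0, 1] ->
    has_derivative t (fun s => psi s b x) (ins G id (psi t) (c t) b x).

Lemma eq_ins_lower (W : lmodType R) (p q : R * int -> seq V -> W) t b x :
  (forall b1 b2, G b1 -> G b2 -> b1 + b2 = b -> multilin (p b1) /\ multilin (q b1)) ->
  (forall b1 b2, G b1 -> G b2 -> b1 + b2 = b -> (rank b1 < rank b)%N ->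
     p b1 =1 q b1) ->
  ins G id p (c t) b x = ins G id q (c t) b x.
Proof.
move=> pql pq; apply: (eq_bsum rG) => b1 b2 g1 g2 bE.
have [b20|b20] := eqVneq b2 0.
  have [pl ql] := pql _ _ g1 g2 bE.
  by rewrite b20 !insert0r// => y; rewrite c0.
apply/eq_insert/(pq _ b2) => //; rewrite -bE; exact: (ranked_lt rG).
Qed.

(* Uniqueness: c vanishes at energy zero, so that the component of psi o c at b
   involves only components of psi of lower rank. *)
Lemma solution_unique (W : lmodType R) (B : set (R * int)) tau
    (psi chi : R -> R * int -> seq V -> W) : enough_functionals W ->
  (forall b1 b2, G b1 -> G b2 -> B (b1 + b2) -> B b1) ->
  (forall t b, t \in `[0, 1] -> B b -> multilin (psi t b) /\ multilin (chi t b)) ->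
  (forall b, B b -> solution psi b /\ solution chi b) ->
  tau \in `[0, 1] -> (forall b x, B b -> psi tau b x = chi tau b x) ->
  forall t b x, t \in `[0, 1] -> B b -> psi t b x = chi t b x.
Proof.
move=> sepW closedB lB solB tau01 eqtau.
suff H n t b x : (rank b < n)%N -> t \in `[0, 1] -> B b -> psi t b x = chi t b x.
  by move=> t b x; apply: (H (rank b).+1).
elim: n t b x => [//|n IHn] t b x; rewrite ltnS => bn t01 Bb.
have [spsi schi] := solB b Bb.
apply/eqP; rewrite -subr_eq0; apply/eqP.
rewrite (has_derivative0_cst (phi := fun t => psi t b x - chi t b x) sepW _ t01 tau01).
  by rewrite eqtau// subrr.
move=> s s01; have := has_derivativeB s01 (spsi s x s01) (schi s x s01).
rewrite (eq_ins_lower (q := chi s)) ?subrr// => b1 b2 g1 g2 bE.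
  by apply: lB => //; apply: (closedB b1 b2); rewrite ?bE.
move=> b1b w; apply: IHn => //; first exact: leq_trans b1b bn.
by apply: (closedB b1 b2); rewrite ?bE.
Qed.

(** Either the outer [p] varies, giving [p'], or one of the inner factors does, and then its
    equation inserts [c] there. A varying [p] is forced by the induction, which absorbs the first
    inner factor into [p]. *)
Lemma has_derivative_blocks (W : lmodType R) l t (f : R -> operations V)
    (p : R -> R * int -> seq V -> W) (p' : R * int -> seq V -> W) b x :
  t \in `[0, 1] -> (forall s b, multilin (f s b)) ->
  (forall b, solution f b) ->
  (forall s b, multilin (p s b)) -> (forall b, multilin (p' b)) ->
  (forall b x, has_derivative t (fun s => p s b x) (p' b x)) ->
  has_derivative t (fun s => blocks G l (p s) (f s) b x)
    (blocks G l p' (f t) b x + ins G id (blocks G l (p t) (f t)) (c t) b x).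
Proof.
move=> t01 fl fs; elim: l p p' b x => [|l IHl] p p' b x pl p'l dp.
  (* With no inner factor only the empty word counts, whereas an insertion always leaves a
     letter. *)
  have -> : ins G id (blocks G 0 (p t) (f t)) (c t) b x = 0.
    apply: (bsum0 rG) => b1 b2 _ _ _; do 2! apply: cutsum0 => ? ? _.
    by case: (map _ _).
  rewrite addr0 /=; case: x => [|? ?]; first exact: dp.
  exact: has_derivative_cst.
rewrite (ins_blocks rG)//.
rewrite [X in X + _]/= -bsumD.
pose F s b1 b2 x1 x2 := blocks G l (fun b' y => p s b' (f s b1 x1 :: y)) (f s) b2 x2.
apply: (has_derivative_bsum (F := fun s b1 b2 => cutsum (F s b1 b2) x) rG) => b1 b2 _ _ _.
rewrite -cutsumD.
apply: (has_derivative_cutsum _ (F := fun s => F s b1 b2)) => x1 x2.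
rewrite addrA -(blocksD rG).
apply: (IHl (fun s b' y => p s b' (f s b1 x1 :: y))).
- by move=> s b'; apply: multilin_cons.
- by move=> b' s1 s2; apply: linear_addP; apply: multilin_cons.
move=> b' y; apply: (has_derivative_apply (F := fun s v => p s b' (v :: y))
  (F' := fun v => p' b' (v :: y)) (phi := fun s => f s b1 x1)) => //.
- by move=> s; apply: (pl s b' [::]).
- exact: (p'l b' [::]).
- exact: fs.
Qed.

Hypothesis continuous_c : forall b x, continuous_curve (fun t => c t b x).
Hypothesis sepV : enough_functionals V.
Variable tau : R.
Hypothesis tau01 : tau \in `[0, 1].

(** The default 0 is never met on a continuous curve. Being chosen separately for each integrand,
    the result is not linear in the integrand by construction. *)
Definition antiderivative (h : R -> V) : R -> V :=
  xget (fun=> 0) [set H | [/\ H tau = 0, continuous_curve H &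
    forall t, t \in `[0, 1] -> has_derivative t H (h t)]].

Lemma antiderivativeP h (H := antiderivative h) : continuous_curve h ->
  [/\ H tau = 0, continuous_curve H &
    forall t, t \in `[0, 1] -> has_derivative t H (h t)].
Proof.
move=> /continuous_curve_antiderivative/(_ tau01)[H0 HP].
exact: (@xgetI _ (fun=> 0) [set H | [/\ H tau = 0, continuous_curve H &
  forall t, t \in `[0, 1] -> has_derivative t H (h t)]] H0 HP).
Qed.

(** Picard iteration from the identity at [tau]. No limit is taken: at each label it becomes
    stationary by [picard_stable]. [clamp] keeps the time in the unit interval, outside which the
    antiderivative is not controlled. *)
Fixpoint picard (n : nat) (t : R) (b : R * int) (x : seq V) : V :=
  if n is n'.+1 then identity b x +
    antiderivative (fun s => ins G id (picard n' s) (c s) b x) (clamp t)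
  else identity b x.

Lemma continuous_ins (f : R -> operations V) b x :
  (forall t b, multilin (f t b)) ->
  (forall b x, continuous_curve (fun t => f t b x)) ->
  continuous_curve (fun s => ins G id (f s) (c s) b x).
Proof.
move=> fl cf.
apply: (continuous_curve_sum _
  (F := fun k s => insert id (f s k.1) (c s k.2) x)) => -[b1 b2].
pose F s a y z := f s b1 (map id a ++ c s b2 y :: z).
apply: (continuous_curve_cutsum _ (F := fun s a => cutsum (F s a))) => a r.
apply: (continuous_curve_cutsum _ (F := fun s => F s a)) => y z.
apply: (continuous_curve_apply (F := fun s v => f s b1 (map id a ++ v :: z))) => //.
by move=> s; apply: fl.
Qed.

(** The properties go through the induction together: integrating the next right-hand side requires
    multilinearity and continuity of the present iterate. *)
Lemma picardP n : [/\ forall b x, continuous_curve (fun t => picard n t b x),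
    forall t b, multilin (picard n t b),
    forall b x, picard n tau b x = identity b x &
    forall t b x, t \in `[0, 1] -> has_derivative t (fun s => picard n.+1 s b x)
      (ins G id (picard n t) (c t) b x)].
Proof.
elim: n => [|n [cn ln taun dn]].
  have cp b x : continuous_curve (fun t => picard 0 t b x).
    exact: continuous_curve_cst.
  have lp t b : multilin (picard 0 t b) by exact: multilin_identity.
  split=> // t b x t01.
  have [_ _ dH] := antiderivativeP (continuous_ins b x lp cp).
  have := has_derivativeD (has_derivative_cst t (identity b x)) (dH t t01).
  by apply: eq_has_derivative; rewrite ?add0r// => s s01; rewrite /= clamp_id.
have anP b x := antiderivativeP (continuous_ins b x ln cn).
have cp b x : continuous_curve (fun t => picard n.+1 t b x).
  have [_ cH _] := anP b x.
  have := continuous_curveD (continuous_curve_cst (identity b x)) cH.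
  by apply: eq_continuous_curve => s s01; rewrite /= clamp_id.
have taup b x : picard n.+1 tau b x = identity b x.
  by have [H0 _ _] := anP b x; rewrite /= clamp_id// H0 addr0.
have lp t b : multilin (picard n.+1 t b).
  move=> s1 s2 a u v.
  suff H s : s \in `[0, 1] -> picard n.+1 s b (s1 ++ (a *: u + v) :: s2) =
      a *: picard n.+1 s b (s1 ++ u :: s2) + picard n.+1 s b (s1 ++ v :: s2).
    have clampE x : picard n.+1 t b x = picard n.+1 (clamp t) b x.
      by rewrite /= (clamp_id (clamp01 t)).
    by rewrite !clampE H// clamp01.
  move=> s01; apply/eqP; rewrite -subr_eq0; apply/eqP.
  (* The defect of linearity has zero derivative, the right-hand side being multilinear, and it
     vanishes at [tau]. *)
  pose phi s := picard n.+1 s b (s1 ++ (a *: u + v) :: s2) -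
    (a *: picard n.+1 s b (s1 ++ u :: s2) + picard n.+1 s b (s1 ++ v :: s2)).
  rewrite -[LHS]/(phi s) (has_derivative0_cst sepV _ s01 tau01).
    by rewrite /phi !taup multilin_identity subrr.
  move=> r r01.
  have scl : linear (fun w : V => a *: w).
    by move=> k w w'; rewrite scalerDr !scalerA mulrC.
  have := has_derivativeB r01 (dn r b (s1 ++ (a *: u + v) :: s2) r01)
    (has_derivativeD (has_derivative_linear r01 scl (dn r b (s1 ++ u :: s2) r01))
       (dn r b (s1 ++ v :: s2) r01)).
  apply: eq_has_derivative => //.
  by rewrite (multilin_ins G b (@linear_id _ _) (ln r) (multilin_c r)) subrr.
split=> // t b x t01.
have [_ _ dH] := antiderivativeP (continuous_ins b x lp cp).
have := has_derivativeD (has_derivative_cst t (identity b x)) (dH t t01).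
by apply: eq_has_derivative; rewrite ?add0r// => s s01; rewrite /= clamp_id.
Qed.

(** The derivatives involve only components of lower rank, which agree by induction, and the values
    at [tau] coincide. *)
Lemma picard_stable n m t b x : t \in `[0, 1] -> (rank b < n)%N -> (rank b < m)%N ->
  picard n t b x = picard m t b x.
Proof.
elim: n m t b x => [//|n IHn] [//|m] t b x t01; rewrite !ltnS => bn bm.
have [[_ ln _ dn] [_ lm _ dm]] := (picardP n, picardP m).
have [[_ _ taun _] [_ _ taum _]] := (picardP n.+1, picardP m.+1).
apply/eqP; rewrite -subr_eq0; apply/eqP.
rewrite (has_derivative0_cst (phi := fun t => picard n.+1 t b x - picard m.+1 t b x)
  sepV _ t01 tau01).
  by rewrite taun taum subrr.
move=> s s01; have := has_derivativeB s01 (dn s b x s01) (dm s b x s01).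
rewrite (eq_ins_lower (q := picard m s)) ?subrr// => b1 b2 g1 g2 bE b1b w.
by apply: IHn => //; [apply: leq_trans b1b bn | apply: leq_trans b1b bm].
Qed.

(** With base point [tau] this is phi^{tau,t}; [(rank b).+1] is the least number of steps to which
    [picard_stable] applies. *)
Definition flow (t : R) : operations V :=
  fun b x => picard (rank b).+1 t b x.

Lemma flow_tau b x : flow tau b x = identity b x.
Proof. by have [_ _ ptau _] := picardP (rank b).+1; apply: ptau. Qed.

Lemma multilin_flow t b : multilin (flow t b).
Proof. by have [_ + _ _] := picardP (rank b).+1; apply. Qed.

(** The derivative of one iterate involves the previous one, but only in components of lower rank,
    where that one already equals [flow]. *)
Lemma flow_solution b : solution flow b.
Proof.
move=> t x t01; have [_ l _ d] := picardP (rank b).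
rewrite (eq_ins_lower (q := picard (rank b) t)); first exact: d.
  by move=> b1 b2 _ _ _; split; [apply: multilin_flow | apply: l].
by move=> b1 b2 _ _ _ b1b w; apply: picard_stable.
Qed.

(** No element of [G] has smaller rank than 0, so the right-hand side of the equation vanishes at
    the label 0. *)
Lemma flow0 t x : t \in `[0, 1] -> flow t 0 x = identity 0 x.
Proof.
move=> t01; rewrite -flow_tau.
apply: (has_derivative0_cst (phi := fun t => flow t 0 x) sepV _ t01 tau01).
move=> s s01; have := flow_solution 0 x s01.
rewrite (eq_ins_lower (q := fun _ _ => 0)).
- apply: eq_has_derivative => //; by apply: (bsum0 rG) => *; apply: insert0l.
- by move=> b1 b2 _ _ _; split=> [|s1 s2 a u v]; [apply: multilin_flow | rewrite scaler0 addr0].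
- move=> b1 b2 g1 g2 bE b1b; exfalso.
  have [b10|b10] := eqVneq b1 0; first by rewrite b10 ltnn in b1b.
  have := ranked_lt rG (ranked0 rG) g1 b10; rewrite add0r => /(ltn_trans b1b).
  by rewrite ltnn.
Qed.

End LinearODE.

Lemma identity_neq0 (R : realType) (V : lmodType R) b x : b != 0 ->
  @identity R V b x = 0.
Proof. by case: x => [|v [|? ?]] //= /negbTE ->. Qed.

(** * Properties of the flow *)

Section Flow.
Variables (R : realType) (G : set (R * int)) (rank : R * int -> nat).
Hypothesis rG : ranked G rank.
Variables (V : lmodType R) (c : R -> operations V).
Hypothesis multilin_c : forall t b, multilin (c t b).
Hypothesis c0 : forall t x, c t 0 x = 0.
Hypothesis continuous_c : forall b x, continuous_curve (fun t => c t b x).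
Hypothesis sepV : enough_functionals V.

Local Notation flow := (flow G rank c).
Local Notation flow_tau := (@flow_tau _ G rank V c multilin_c continuous_c sepV).
Local Notation flow0 := (flow0 rG multilin_c c0 continuous_c sepV).
Local Notation multilin_flow := (@multilin_flow _ G rank V c multilin_c continuous_c sepV).
Local Notation flow_solution := (flow_solution rG multilin_c c0 continuous_c sepV).

Lemma multilin0 : multilin (fun _ : seq V => 0 : V).
Proof. by move=> ? ? ? ? ?; rewrite scaler0 addr0. Qed.

Lemma multilin_compose (p f : operations V) b : G b ->
  (forall b, multilin (p b)) -> (forall b, multilin (f b)) -> f 0 [::] = 0 ->
  multilin (compose G p f b).
Proof.
move=> gb pl fl f0 s1 s2 a u v.
pose L := (rank b + size (s1 ++ u :: s2)).+1.
have bL w : (rank b + size (s1 ++ w :: s2) < L)%N by rewrite /L !size_cat.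
rewrite !(compose_blocks rG gb pl f0 (bL _)).
rewrite scaler_sumr -big_split; apply: eq_bigr => l _.
by rewrite (multilin_blocks G l b pl fl).
Qed.

Lemma compose_identity (p : operations V) b x : G b ->
  (forall b, multilin (p b)) -> compose G p (@identity R V) b x = p b x.
Proof.
move=> gb pl; rewrite (compose_blocks rG gb pl erefl (ltnSn _)).
have szL : (size x < (rank b + size x).+1)%N by rewrite ltnS leq_addl.
rewrite (bigD1 (Ordinal szL))//= big1 => [|l lx].
  by rewrite (blocks_identity rG)// eqxx addr0.
by rewrite (blocks_identity rG)//; case: eqP => // e; case/eqP: lx; apply: val_inj.
Qed.

(** Block by block this is [has_derivative_blocks] with [p] constant in time; the blocks are then
    summed up to one common bound. *)
Lemma compose_solution (p : operations V) tau b : tau \in `[0, 1] ->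
  (forall b, multilin (p b)) -> G b ->
  solution G c (fun t => compose G p (flow tau t)) b.
Proof.
move=> tau01 pl gb t x t01.
(* One more than [x] alone requires: inserting the value of [c] at the empty word lengthens the word
   by a letter, and the right-hand side is expanded with the same [L]. *)
pose L := (rank b + size x).+2.
have fl s b' : multilin (flow tau s b') by apply: multilin_flow.
have compE s b' y : s \in `[0, 1] -> G b' -> (rank b' <= rank b)%N ->
    (size y <= (size x).+1)%N ->
    compose G p (flow tau s) b' y = \sum_(l < L) blocks G l p (flow tau s) b' y.
  move=> s01 gb' rb yx; apply: (compose_blocks rG) => //; first by rewrite flow0.
  by rewrite /L ltnS -addnS leq_add.
have dblocks (l : 'I_L) : has_derivative t (fun s => blocks G l p (flow tau s) b x)
    (ins G id (blocks G l p (flow tau t)) (c t) b x).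
  rewrite -[X in has_derivative _ _ X]add0r -(blocks0 rG V l (flow tau t) b x).
  apply: (has_derivative_blocks rG) => //.
  - by move=> b'; apply: flow_solution.
  - by move=> b'; apply: multilin0.
  - by move=> b' y; apply: has_derivative_cst.
have := has_derivative_sum (r := index_enum 'I_L) (fun l _ => dblocks l).
apply: eq_has_derivative => [s s01|]; first by rewrite -compE.
transitivity (bsum G b (fun b1 b2 => insert id (fun w =>
    \sum_(l < L) blocks G l p (flow tau t) b1 w) (c t b2) x)).
  rewrite [LHS]exchange_big; apply: eq_bigr => k _; exact/esym/insert_suml.
apply: (eq_bsum rG) => b1 b2 g1 g2 bE; apply: eq_cutsum => a r xE; apply: eq_cutsum => y z rE.
rewrite -compE//.
  have [b20|b20] := eqVneq b2 0; first by rewrite -bE b20 addr0.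
  by rewrite -bE ltnW// (ranked_lt rG).
by rewrite -xE -rE map_id !size_cat /= addnS ltnS leq_add2l leq_addl.
Qed.

(* Both sides solve the same equation in t. *)
Lemma compose_flow sigma tau t b x : sigma \in `[0, 1] -> tau \in `[0, 1] ->
  t \in `[0, 1] -> G b ->
  compose G (flow sigma tau) (flow tau t) b x = flow sigma t b x.
Proof.
move=> sigma01 tau01 t01.
have ml s b' : multilin (flow sigma s b') by apply: multilin_flow.
apply: (solution_unique rG c0 (B := G) (tau := tau)
  (psi := fun t => compose G (flow sigma tau) (flow tau t))
  (chi := flow sigma)) => // [s b' s01 gb'|b' gb'|b' y gb'].
- split=> //; apply: multilin_compose => // [b''|]; first exact: multilin_flow.
  by rewrite flow0.
- split; first exact: compose_solution.
  exact: flow_solution.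
- rewrite -[RHS]compose_identity//; apply: eq_fsbigr => q _; congr (flow _ _ _ _).
  by apply: eq_map => r; apply: flow_tau.
Qed.

(** * The homomorphism relation *)

Section Homomorphism.
Variables (B : set (R * int)) (sg : V -> V) (m : R -> operations V).
Hypothesis BG : B `<=` G.
Hypothesis B_lower : forall b1 b2, G b1 -> G b2 -> B (b1 + b2) -> B b1.
Hypothesis linear_sg : linear sg.
Hypothesis sg_c : forall t b w, sg (c t b w) = c t b (map sg w).
Hypothesis multilin_m : forall t b, multilin (m t b).
Hypothesis derivative_m : forall t b x, t \in `[0, 1] -> B b ->
  has_derivative t (fun s => m s b x)
    (ins G id (m t) (c t) b x - ins G sg (c t) (m t) b x).

Lemma ins_identity (q : operations V) b x : G b ->
  ins G sg (@identity R V) q b x = q b x.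
Proof.
move=> gb; rewrite /ins (bsum_single rG)//; last first.
  move=> b1 b2 b10; do 2! apply: cutsum0 => ? ? _.
  exact: identity_neq0.
rewrite /insert cutsum_left => [|v a r]; last first.
  by apply: cutsum0 => y z _; case: a.
by rewrite cutsum_right//= eqxx.
Qed.

(** The product rule gives (phi o c) o m + phi o (m o c - c o m), which [ins_commutator] turns into
    (phi o m) o c. The set [B] contains, with [b], the labels at which [m] has to be
    differentiated. *)
Lemma ins_flow_solution tau b : tau \in `[0, 1] -> B b ->
  solution G c (fun t => ins G sg (flow tau t) (m t)) b.
Proof.
move=> tau01 Bb t x t01.
have fl s b' : multilin (flow tau s b') by apply: multilin_flow.
pose dm b x := ins G id (m t) (c t) b x - ins G sg (c t) (m t) b x.
have -> : ins G id (ins G sg (flow tau t) (m t)) (c t) b x =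
    ins G sg (ins G id (flow tau t) (c t)) (m t) b x
  + ins G sg (flow tau t) dm b x.
  have := ins_commutator rG (m t) b x linear_sg (fl t) (sg_c t).
  move=> /eqP; rewrite -subr_eq => /eqP <-; rewrite -addrA; congr (_ + _).
  rewrite /ins /bsum -sumrB; apply: eq_bigr => k _.
  by rewrite -insertBr.
rewrite /ins -bsumD.
apply: (has_derivative_bsum (F := fun s b1 b2 =>
  insert sg (flow tau s b1) (m s b2) x) rG) => b1 b2 g1 g2 bE.
rewrite /insert -cutsumD.
pose F s a y z := flow tau s b1 (map sg a ++ m s b2 y :: z).
apply: (has_derivative_cutsum (F := fun s a => cutsum (F s a))) => a r.
rewrite -cutsumD; apply: (has_derivative_cutsum (F := fun s => F s a)) => y z.
apply: (has_derivative_apply (F := fun s v => flow tau s b1 (map sg a ++ v :: z))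
  (F' := fun v => ins G id (flow tau t) (c t) b1 (map sg a ++ v :: z))
  (phi := fun s => m s b2 y)) => //.
- by move=> s; apply: fl.
- exact: (multilin_ins G b1 (@linear_id _ _) (fl t) (multilin_c t)).
- by move=> v; apply: flow_solution.
- by apply: derivative_m => //; apply: (B_lower g2 g1); rewrite addrC bE.
Qed.

Lemma flow_homomorphism tau t b x : tau \in `[0, 1] -> t \in `[0, 1] -> B b ->
  ins G sg (flow tau t) (m t) b x = compose G (m tau) (flow tau t) b x.
Proof.
move=> tau01 t01 Bb.
have fl s b' : multilin (flow tau s b') by apply: multilin_flow.
apply: (solution_unique rG c0 (B := B) (tau := tau)
  (psi := fun t => ins G sg (flow tau t) (m t))
  (chi := fun t => compose G (m tau) (flow tau t))) => //.
- move=> s b' s01 Bb'; split.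
    exact: (multilin_ins G b' linear_sg (fl s) (multilin_m s)).
  by apply: multilin_compose => //; [apply: BG | rewrite flow0].
- move=> b' Bb'; split; first exact: ins_flow_solution.
  by apply: compose_solution => //; apply: BG.
move=> b' y Bb'; have gb' := BG Bb'.
transitivity (m tau b' y).
  rewrite -[RHS]ins_identity//; apply: (eq_bsum rG) => b1 b2 _ _ _.
  by apply: eq_insert => w; apply: flow_tau.
rewrite -[LHS]compose_identity//; apply: eq_fsbigr => q _; congr (m _ _ _).
by apply: eq_map => r; rewrite flow_tau.
Qed.

End Homomorphism.

(** * Degrees of the flow *)

Section Degree.
Variables (C : int -> set V) (comp : int -> V -> V).
Hypothesis C0 : forall j, C j 0.
Hypothesis CD : forall j u v, C j u -> C j v -> C j (u + v).
Hypothesis linear_comp : forall i, linear (comp i).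
Hypothesis compP : forall j v, C j v <-> forall i, i != j -> comp i v = 0.
Hypothesis degree_c : forall t b, has_degree C (c t b) (0 - b.2).

Lemma C_sum (I : eqType) (r : seq I) (F : I -> V) j :
  (forall i, i \in r -> C j (F i)) -> C j (\sum_(i <- r) F i).
Proof.
by move=> CF; rewrite big_seq; apply: (big_ind (C j)) => // u v; apply: CD.
Qed.

Lemma C_cutsum T (F : seq T -> seq T -> V) x j :
  (forall a b, a ++ b = x -> C j (F a b)) -> C j (cutsum F x).
Proof.
by move=> CF; rewrite cutsumE; apply: C_sum => k _; apply: CF; apply: cat_take_drop.
Qed.

(** By induction on the rank the right-hand side of the equation has the expected degree, so every
    other component of the flow has zero derivative and keeps its value at [tau], which is 0. *)
Lemma degree_flow tau t b : tau \in `[0, 1] -> t \in `[0, 1] ->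
  has_degree C (flow tau t b) (0 - b.2).
Proof.
move=> tau01; have [n] := ubnP (rank b); elim: n t b => // n IHn t b.
rewrite ltnS => bn t01 d x hx.
have Cid : C (sdeg d + (0 - b.2) + 1) (identity b x).
  case: x hx => [|v [|? ?]] // hx; rewrite /identity; case: eqP => // -> /=.
  have [] := hx; case: d hx => [|k [|? ?]] // _ _ /(_ 0%N isT) /=.
  by rewrite /sdeg big_seq1 oppr0 !addr0 subrK.
set j := (X in C X _) in Cid *.
apply/compP => i ij.
have -> : comp i (flow tau t b x) = comp i (flow tau tau b x).
  apply: (has_derivative0_cst (phi := fun t => comp i (flow tau t b x))) => // s s01.
  have := has_derivative_linear s01 (linear_comp i) (flow_solution tau01 b x s01).
  apply: eq_has_derivative => //; move: i ij; apply/compP.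
  apply: C_sum => -[b1 b2] /(splitsP rG)[/= g1 g2 bE].
  apply: C_cutsum => a r xE; apply: C_cutsum => y z rE; rewrite map_id.
  have [b20|b20] := eqVneq b2 0.
    rewrite b20 c0 (linear0P (multilin_flow tau01 _ _ _ _)).
    exact: C0.
  move: hx; rewrite -xE -rE => /homogeneous_catP[da [dr [dE ha /homogeneous_catP]]].
  move=> [dy [dz [rdE hy hz]]].
  have hc : homogeneous C (da ++ (sdeg dy + (0 - b2.2) + 1) :: dz) (a ++ c s b2 y :: z).
    by apply: homogeneous_cat => //; apply/homogeneous_cons; split=> //; apply: degree_c.
  have b1b : (rank b1 < n)%N by apply: leq_trans bn; rewrite -bE (ranked_lt rG).
  have := IHn s b1 b1b s01 _ _ hc; congr (C _ _).
  rewrite /j dE rdE !sdeg_cat sdeg_cons -bE /=; lia.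
by rewrite (flow_tau tau01); move: i ij; apply/compP.
Qed.

End Degree.

(** * Cyclicity of the flow *)

Section Pairing.
Variable P : V -> V -> R^o.
Hypothesis linearPl : forall v, linear (P^~ v).
Hypothesis linearPr : forall u, linear (P u).
Hypothesis cyclicP : forall t b x0 r,
  P (c t b (belast x0 r)) (last x0 r) = - P x0 (c t b r).

(** The sum in the definition of a cyclic homomorphism, viewed as a family with values in [R^o] so
    that uniqueness of solutions applies to it. *)
Definition pairing_sum (f : operations V) (b : R * int) (x : seq V) : R^o :=
  bsum G b (fun b1 b2 => cutsum (fun x1 x2 => P (f b1 x1) (f b2 x2)) x).

Lemma multilin_pairing_sum f b : (forall b, multilin (f b)) ->
  multilin (pairing_sum f b).
Proof.
move=> fl; apply: (@multilin_convolution _ G V _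
  (fun b1 b2 x1 x2 => P (f b1 x1) (f b2 x2))) => b1 b2 y s1 s2 a u v.
  by rewrite fl linearPl.
by rewrite fl linearPr.
Qed.

Lemma pairing_sum_solution tau b : tau \in `[0, 1] ->
  solution G c (fun t => pairing_sum (flow tau t)) b.
Proof.
move=> tau01 t x t01; rewrite [X in has_derivative _ _ X](ins_convolution rG
  (fun b1 b2 x1 x2 => P (flow tau t b1 x1) (flow tau t b2 x2))).
apply: (has_derivative_bsum (F := fun s b1 b2 => cutsum (fun x1 x2 =>
  P (flow tau s b1 x1) (flow tau s b2 x2)) x) rG) => b1 b2 _ _ _.
apply: (has_derivative_cutsum (F := fun s x1 x2 =>
  P (flow tau s b1 x1) (flow tau s b2 x2))) => x1 x2.
have := @has_derivative_apply _ _ _ t (fun s v => P (flow tau s b1 x1) v)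
  (fun v => P (ins G id (flow tau t) (c t) b1 x1) v) (fun s => flow tau s b2 x2)
  (ins G id (flow tau t) (c t) b2 x2) t01.
move=> /(_ (fun s => linearPr _) (linearPr _) _ (flow_solution tau01 _ _ t01)) H.
apply: eq_has_derivative (H _) => // [|v]; last first.
  by apply: (has_derivative_linear t01 (linearPl v)); apply: flow_solution.
congr (_ + _).
  rewrite (raddf_bsum _ _ _ (linearDP (linearPl _)) (linear0P (linearPl _))).
  apply: (eq_bsum rG) => b1' b3 _ _ _.
  exact: (raddf_insert _ _ _ _ (linearPl _)).
rewrite (raddf_bsum _ _ _ (linearDP (linearPr _)) (linear0P (linearPr _))).
apply: (eq_bsum rG) => b1' b3 _ _ _.
exact: (raddf_insert _ _ _ _ (linearPr _)).
Qed.

Definition pair_word (x : seq V) : R^o := if x is [:: u; v] then P u v else 0.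

Lemma pairing_sum_identity b x :
  pairing_sum (@identity R V) b x = if b == 0 then pair_word x else 0.
Proof.
have [gb|ngb] := pselect (G b); last first.
  rewrite /pairing_sum (bsum0 rG) => [|b1 b2 g1 g2 bE].
    by case: eqVneq => // b0; case: ngb; rewrite b0; apply: (ranked0 rG).
  by case: ngb; rewrite -bE; apply: (rankedD rG).
rewrite /pairing_sum (bsum_single rG)//; last first.
  move=> b1 b2 b10; apply: cutsum0 => x1 x2 _.
  by rewrite identity_neq0// (linear0P (linearPl _)).
case: eqVneq => [->|b0]; last first.
  apply: cutsum0 => x1 x2 _.
  by rewrite (identity_neq0 _ b0) (linear0P (linearPr _)).
have [Pl Pr] := (fun v => linear0P (linearPl v), fun u => linear0P (linearPr u)).
case: x => [|u [|v [|w x]]] /=; rewrite ?eqxx ?Pl ?Pr ?add0r ?addr0//.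
by apply: cutsum0 => x1 x2 _; case: x1 => [|? ?]; rewrite /= ?Pl.
Qed.

(** A word of two letters remains only if [c] takes all letters but the last or all but the first.
    Cyclic symmetry cancels these two terms, so the pairing is a constant solution. *)
Lemma insert_pair_word t b x : insert id pair_word (c t b) x = 0.
Proof.
case: x => [|x0 r]; first by rewrite /insert /= !addr0.
rewrite -[LHS]/(cutsum (fun y z => pair_word (c t b y :: z)) (x0 :: r) +
  cutsum (fun a => cutsum (fun y z => pair_word (x0 :: map id a ++ c t b y :: z))) r).
have -> : cutsum (fun y z => pair_word (c t b y :: z)) (x0 :: r) =
    P (c t b (belast x0 r)) (last x0 r).
  rewrite -(cutsum_last (fun y v => P (c t b y) v)).
  by apply: eq_cutsum => y z _; case: z => [|? [|? ?]].
rewrite cutsum_left => [|v a r']; last first.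
  by apply: cutsum0 => y z _; rewrite /=; case: (map _ a).
rewrite cutsum_right => [|y v z]; last by [].
by rewrite /= cyclicP addNr.
Qed.

Lemma pairing_flow tau t b x : tau \in `[0, 1] -> t \in `[0, 1] -> G b ->
  pairing_sum (flow tau t) b x = if b == 0 then pair_word x else 0.
Proof.
move=> tau01 t01 gb; rewrite -pairing_sum_identity//.
apply: (solution_unique rG c0 (B := G) (tau := tau)
  (psi := fun t => pairing_sum (flow tau t))
  (chi := fun _ => pairing_sum (@identity R V))) => //.
- exact: enough_functionals_regular.
- move=> s b' _ _; split; apply: multilin_pairing_sum => b''.
    exact: multilin_flow.
  exact: multilin_identity.
- move=> b' gb'; split; first exact: pairing_sum_solution.
  move=> s y s01; have -> : ins G id (pairing_sum (@identity R V)) (c s) b' y = 0.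
    rewrite /ins (bsum_single rG)//.
      rewrite -[RHS](insert_pair_word s b' y); apply: eq_insert => w.
      by rewrite pairing_sum_identity eqxx.
    move=> b1 b2 b10; rewrite -[RHS](insert0l _ id (c s b2) y).
    by apply: eq_insert => w; rewrite pairing_sum_identity (negbTE b10).
  exact: has_derivative_cst.
move=> b' y gb'; apply: (eq_bsum rG) => b1 b2 _ _ _; apply: eq_cutsum => x1 x2 _.
by rewrite !flow_tau.
Qed.

End Pairing.

(** The derivative vanishes. A block of [c] containing [e] gives 0; otherwise the new word has both
    [e] and the value of [c], hence at least two letters, and there the components of lower rank
    equal the identity family, which is 0. *)
Lemma flow_unital e tau t b s1 s2 :
  (forall t b s1 s2, t \in `[0, 1] -> c t b (s1 ++ e :: s2) = 0) ->
  tau \in `[0, 1] -> t \in `[0, 1] ->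
  flow tau t b (s1 ++ e :: s2) = identity b (s1 ++ e :: s2).
Proof.
move=> ce tau01; have [n] := ubnP (rank b); elim: n t b s1 s2 => // n IHn t b s1 s2.
rewrite ltnS => bn t01; rewrite -(flow_tau tau01 b).
apply: (has_derivative0_cst (phi := fun t => flow tau t b (s1 ++ e :: s2))) => // s s01.
have := flow_solution tau01 b (s1 ++ e :: s2) s01; apply: eq_has_derivative => //.
have fl b1 a z : flow tau s b1 (a ++ 0 :: z) = 0.
  exact: (linear0P (multilin_flow tau01 _ _ _ _)).
have vanish b1 b2 a y z : G b1 -> G b2 -> b1 + b2 = b -> (0 < size a + size z)%N ->
    (exists u1 u2, a ++ c s b2 y :: z = u1 ++ e :: u2) ->
    flow tau s b1 (a ++ c s b2 y :: z) = 0.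
  move=> g1 g2 bE sz [u1 [u2 uE]].
  have [b20|b20] := eqVneq b2 0; first by rewrite b20 c0 fl.
  rewrite uE IHn//; last by apply: leq_trans bn; rewrite -bE (ranked_lt rG).
  have := congr1 size uE; rewrite size_cat /= addnS => szE.
  by case: u1 uE szE => [|? [|? ?]] _; case: u2 => [|? ?] //=; rewrite ?addn0 ?size_cat /=; lia.
apply: (bsum0 rG) => b1 b2 g1 g2 bE; rewrite insert_mark.
rewrite [X in _ + X + _]cutsum0 => [|a1 a2 _]; last first.
  by apply: cutsum0 => z1 z2 _; rewrite ce// fl.
rewrite addr0 [X in X + _]cutsum0 ?add0r => [|a r _]; last first.
  apply: cutsum0 => y z _; rewrite map_id -catA /=; apply: vanish => //.
    by rewrite size_cat /= !addnS.
  by exists (a ++ c s b2 y :: z), s2; rewrite -catA.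
apply: cutsum0 => a r _; apply: cutsum0 => y z _; rewrite !map_id.
rewrite -cat_cons catA; apply: vanish => //.
  by rewrite size_cat /= !addnS.
by exists s1, (a ++ c s b2 y :: z); rewrite -catA.
Qed.

End Flow.

(** * Gapped monoids and graded spaces *)

Section Gapping.
Variables (R : realType) (G : set (R * int)).
Hypothesis gG : gapping_monoid G.

Lemma energy_gap b : G b -> exists2 d : R, 0 < d &
  forall b', G b' -> `|b'.1 - b.1| < d -> b'.1 = b.1.
Proof.
move=> gb; have Eb : (fst @` G) b.1 by exists b.
have [_ [U /nbhs_ballP[d /= d0 dU] UE]] := gapping_discrete gG Eb.
exists d => // b' gb' bd.
have : (U `&` (fst @` G)) b'.1.
  by split; [apply: dU; rewrite /ball /= distrC | exists b'].
by rewrite UE.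
Qed.

(** If (0, k) with k nonzero were in [G], its multiples would be infinitely many elements of energy
    0. *)
Lemma gapping_energy0 b : G b -> b.1 = 0 -> b = 0.
Proof.
case: b => e k gb /= e0; rewrite {e}e0 in gb *.
apply/eqP; apply: contraT; rewrite xpair_eqE eqxx /= => k0.
have [s sE] := (finite_seqP _).1 (gapping_finite gG 0).
have gn i : G (0, k *+ i).
  elim: i => [|i IHi]; first by rewrite mulr0n; apply: (gapping0 gG).
  by rewrite mulrS -[X in G (X, _)](addr0 0); apply: (gappingD gG gb IHi).
pose r := [seq ((0 : R), k *+ i) | i <- iota 0 (size s).+1].
have ur : uniq r.
  rewrite map_inj_uniq ?iota_uniq// => i j [].
  exact: mulrIn.
have rs : {subset r <= s}.
  move=> b /mapP[i _ ->]; have : [set` s] ((0 : R), k *+ i) by rewrite -sE.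
  by [].
by have := uniq_leq_size ur rs; rewrite size_map size_iota ltnn.
Qed.

(* Two splittings b = b1 + b2 = b1' + b2' with close energies E(b1), E(b1')
   have E(b1 + b2') close to E(b), hence equal to it: the energies of the
   summands of b are uniformly separated. *)
Lemma finite_splittings b : finite_set (splittings G b).
Proof.
pose A := [set b1 | G b1 /\ G (b - b1)].
suff fA : finite_set A.
  apply: (sub_finite_set (B := (fun b1 => (b1, b - b1)) @` A)); last exact: finite_image.
  move=> [b1 b2] [/= g1 g2 bE]; exists b1.
    by split=> //; rewrite -bE addrAC subrr add0r.
  by rewrite -bE addrAC subrr add0r.
have [gb|ngb] := pselect (G b); last first.
  rewrite (_ : A = set0) ?finite_set0// -subset0 => b1 [g1 g2].
  by apply: ngb; rewrite -(subrK b1 b); apply: (gappingD gG).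
have [d d0 dP] := energy_gap gb.
have fE : finite_set (fst @` A).
  (* [h] numbers the cells of width [d]. Energies of summands in the same cell coincide, and none
     exceeds the energy of [b], so finitely many cells occur. *)
  pose h (e : R) := Num.truncn (e / d).
  have hinj : {in fst @` A &, injective h}.
    move=> e1 e2; rewrite !inE => -[b1 [g1 g1'] <-] [b2 [g2 g2'] <-] h12.
    have [p1 p2] : 0 <= b1.1 / d /\ 0 <= b2.1 / d.
      by split; apply: divr_ge0 (ltW d0); apply: (gapping_energy gG).
    have /andP[l1 u1] := truncn_itv p1; have /andP[l2 u2] := truncn_itv p2.
    rewrite -/(h _) in l1 u1; rewrite -/(h _) -h12 in l2 u2.
    rewrite -natr1 in u1 u2.
    have := dP _ (gappingD gG g1 g2') => /=.
    have -> : b1.1 + (b.1 - b2.1) - b.1 = (b1.1 / d - b2.1 / d) * d.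
      by rewrite mulrBl !divfK ?gt_eqF// addrCA addrAC subrr add0r.
    rewrite normrM (gtr0_norm d0) gtr_pMl// => dP'.
    have : b1.1 + (b.1 - b2.1) = b.1 by apply: dP'; rewrite ltr_norml; lra.
    by move=> /eqP; rewrite addrCA -subr_eq0 addrAC subrr add0r subr_eq0 => /eqP.
  rewrite -(eq_finite_set (inj_card_eq hinj)).
  apply: (sub_finite_set (B := `I_(h b.1).+1)); last exact: finite_II.
  move=> _ [_ [b1 [g1 g1'] <-] <-] /=; rewrite ltnS; apply: le_truncn.
  rewrite ler_pM2r ?invr_gt0//.
  by have := gapping_energy gG g1' => /=; rewrite subr_ge0.
apply: (sub_finite_set (B := \bigcup_(e in fst @` A) [set b1 | G b1 /\ b1.1 = e])).
  by move=> b1 Ab1; exists b1.1; [exists b1 | split=> //; case: Ab1].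
by apply: bigcup_finite => // e _; apply: (gapping_finite gG).
Qed.

(** Nonzero elements have energy at least the gap [d] at 0, so the integer part of E/d grows by at
    least one when such an element is added. Counting the energies below E(b) would not do, as they
    can be infinitely many when E(G) is not closed. *)
Lemma gapping_ranked : exists rank, ranked G rank.
Proof.
have [d d0 dP] := energy_gap (gapping0 gG).
exists (fun b => Num.truncn (b.1 / d)); split.
- exact: (gapping0 gG).
- exact: (gappingD gG).
- exact: finite_splittings.
move=> b b' gb gb' b'0 /=.
have db' : d <= b'.1.
  rewrite leNgt; apply: contra b'0 => b'd; apply/eqP/gapping_energy0 => //.
  by apply: (dP b' gb'); rewrite /= subr0 ger0_norm//; apply: (gapping_energy gG).
have p0 : 0 <= b.1 / d.
  by apply: divr_ge0 (ltW d0); apply: (gapping_energy gG).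
rewrite truncn_gt_nat mulrDl -natr1.
have /andP[l _] := truncn_itv p0; apply: lerD => //.
by rewrite ler_pdivlMr// mul1r.
Qed.

End Gapping.

Section Grading.
Variables (R : realType) (V : lmodType R) (C : int -> set V).
Hypothesis gC : grading C.

Definition component (j : int) (v : V) : V := sval (cid (grading_sum gC v)) j.

Lemma component_spec v : [/\ forall j, C j (component j v),
  finite_set [set j | component j v != 0] &
  v = \sum_(j \in [set: int]) component j v].
Proof. by rewrite /component; case: cid => u []. Qed.

Lemma component_uniq v (u : int -> V) : (forall j, C j (u j)) ->
  finite_set [set j | u j != 0] -> v = \sum_(j \in [set: int]) u j ->
  forall j, component j v = u j.
Proof.
move=> Cu fu vE j; rewrite /component; case: cid => u' [/= _ /(_ u)] -> //.
Qed.

Lemma linear_component j : linear (component j).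
Proof.
move=> a u v; have [[Cu fu uE] [Cv fv vE]] := (component_spec u, component_spec v).
apply: (component_uniq (u := fun j => a *: component j u + component j v)).
- by move=> i; apply: (gradingP gC).
- apply: (sub_finite_set
    (B := [set j | component j u != 0] `|` [set j | component j v != 0])).
    move=> i /=; have [u0|u0 _] := eqVneq (component i u) 0; last by left.
    by rewrite u0 scaler0 add0r; right.
  by rewrite finite_setU.
by rewrite fsum_linear// -uE -vE.
Qed.

Lemma component_ext u v : (forall j, component j u = component j v) -> u = v.
Proof.
move=> e; have [_ _ ->] := component_spec u; have [_ _ ->] := component_spec v.
by apply: eq_fsbigr.
Qed.

Lemma fsum_single (u : int -> V) j : (forall i, i != j -> u i = 0) ->
  \sum_(i \in [set: int]) u i = u j.
Proof.
move=> u0; transitivity (\sum_(i \in [set j]) u i); last exact: fsbig_set1.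
by apply/esym/fsbig_widen => // i [_ ij] /=; apply: u0; apply/eqP.
Qed.

Lemma componentP j v : C j v <-> forall i, i != j -> component i v = 0.
Proof.
split=> [Cv i ij|v0]; last first.
  have [Cc _ ->] := component_spec v.
  by rewrite (fsum_single (j := j)).
rewrite (component_uniq (u := fun k => if k == j then v else 0)) ?(negbTE ij)//.
- by move=> k; case: eqP => [->//|_]; apply: (grading0 gC).
- apply: (sub_finite_set (B := [set j])) => [k /=|]; last exact: finite_set1.
  by case: (k =P j) => //; rewrite eqxx.
- by rewrite (fsum_single (j := j)) ?eqxx// => k /negbTE ->.
Qed.

(** The Koszul sign as a linear operator: the sign of the shifted degree on each homogeneous
    component. *)
Definition parity (v : V) : V :=
  \sum_(j \in [set: int]) (-1) ^ (j - 1) *: component j v.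

Lemma component_parity j v : component j (parity v) = (-1) ^ (j - 1) *: component j v.
Proof.
have [Cv fv _] := component_spec v.
apply: (component_uniq (u := fun j => (-1) ^ (j - 1) *: component j v)) => // [i|].
  by rewrite -[X in C i X]addr0; apply: (gradingP gC) => //; apply: (grading0 gC).
apply: sub_finite_set fv => i /=; apply: contra => /eqP ->.
by rewrite scaler0.
Qed.

Lemma linear_parity : linear parity.
Proof.
move=> a u v; apply: component_ext => j.
rewrite linear_component !component_parity linear_component scalerDr.
by rewrite !scalerA mulrC.
Qed.

Lemma parityE j v : C j v -> parity v = (-1) ^ (j - 1) *: v.
Proof.
move=> Cv; apply: component_ext => i.
rewrite component_parity (linearZP _ _ (linear_component i)).
by have [->//|ij] := eqVneq i j; rewrite ((componentP j v).1 Cv)// !scaler0.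
Qed.

Lemma vector_ind (P : V -> Prop) : (forall j v, C j v -> P v) ->
  (forall u w, P u -> P w -> P (u + w)) -> forall v, P v.
Proof.
move=> PC PD v; have [Cv fv ->] := component_spec v.
rewrite (fsbigTE (fset_set [set j | component j v != 0]))//=.
  apply: (big_ind P) => // [|j _]; first exact: PC (grading0 gC 0).
  exact: PC (Cv j).
move=> j; rewrite in_fset_set// => /negP; rewrite inE /= => /negP.
by rewrite negbK => /eqP.
Qed.

(** Letters are decomposed one at a time from the left, behind a prefix [h] that is already
    homogeneous. Claims additive in each letter are thereby reduced to homogeneous words. *)
Lemma word_ind (P : seq V -> Prop) : (forall d x, homogeneous C d x -> P x) ->
  (forall s1 s2 u w, P (s1 ++ u :: s2) -> P (s1 ++ w :: s2) ->
     P (s1 ++ (u + w) :: s2)) -> forall x, P x.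
Proof.
move=> PC PD x.
suff H : forall d h, homogeneous C d h -> P (h ++ x) by apply: (H [::] [::]).
elim: x => [|v x IHx] d h hh; first by rewrite cats0; apply: PC hh.
apply: (@vector_ind (fun v => P (h ++ v :: x))) => [j u Cu|u w]; last exact: PD.
rewrite -cat_rcons; apply: (IHx (d ++ [:: j])).
by rewrite -cats1; apply: homogeneous_cat => //; apply/homogeneous_cons.
Qed.

End Grading.

(** * Pseudo-isotopies *)

Section Isotopy.
Variables (R : realType) (V : lmodType R) (C : int -> set V) (n : int)
  (pair : V -> V -> R) (G : set (R * int)) (E : \bar R)
  (m c : R -> operations V).
Hypothesis gG : gapping_monoid G.
Hypothesis gC : grading C.
Hypothesis iso : pseudo_isotopy C n pair G E m c.
Variable rank : R * int -> nat.
Hypothesis rG : ranked G rank.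

Local Notation B := (below G E).
Local Notation sg := (parity gC).

Lemma below_lower b1 b2 : G b1 -> G b2 -> B (b1 + b2) -> B b1.
Proof.
move=> g1 g2 [_ bE]; split=> //; apply: le_lt_trans bE.
by rewrite lee_fin lerDl; apply: (gapping_energy gG).
Qed.

(* Outside G modulo T^E and outside [0,1] nothing is known of the operations;
   after truncation multilinearity, degree and cyclicity hold everywhere. *)
Definition truncation (f : R -> operations V) (t : R) : operations V :=
  fun b x => if `[< B b >] then f (clamp t) b x else 0.

Lemma truncationE f t b x : t \in `[0, 1] -> B b -> truncation f t b x = f t b x.
Proof. by move=> t01 Bb; rewrite /truncation asboolT// clamp_id. Qed.

Lemma multilin_truncation f r : (forall t, t \in `[0, 1] ->
    graded_operations C G E r (f t)) ->
  forall t b, multilin (truncation f t b).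
Proof.
move=> fl t b s1 s2 a u v; rewrite /truncation; case: asboolP => [Bb|_].
  exact: (op_multilinear (fl _ (clamp01 t)) Bb).
by rewrite scaler0 addr0.
Qed.

Local Notation m' := (truncation m).
Local Notation c' := (truncation c).

Lemma multilin_m' t b : multilin (m' t b).
Proof.
by apply: (multilin_truncation (r := 1)) => s /(iso_ainf iso); apply: ainf_graded.
Qed.

Lemma multilin_c' t b : multilin (c' t b).
Proof. exact: multilin_truncation (iso_graded iso) t b. Qed.

Lemma c'0 t x : c' t 0 x = 0.
Proof.
by rewrite /truncation; case: asboolP => // _; apply: (iso_c0 iso); apply: clamp01.
Qed.

Lemma continuous_c' b x : continuous_curve (fun t => c' t b x).
Proof.
have [Bb|nBb] := pselect (B b).
  apply: eq_continuous_curve (smooth_curve_continuous (iso_smooth_c iso x Bb)).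
  by move=> t t01; rewrite truncationE.
by apply: continuous_curve0 => t _; rewrite /truncation asboolF.
Qed.

Lemma degree_c' t b : has_degree C (c' t b) (0 - b.2).
Proof.
move=> d x hx; rewrite /truncation; case: asboolP => [Bb|_].
  exact: (op_degree (iso_graded iso (clamp01 t)) Bb hx).
exact: (grading0 gC).
Qed.

Lemma even_sign k l : (2 %| l)%Z -> (-1) ^ (k + l) = (-1) ^ k :> R.
Proof.
move=> /dvdzP[q ->]; rewrite exprzDr ?unitrN1//.
have -> : (-1) ^ (q * 2) = 1 :> R; last by rewrite mulr1.
by rewrite mulrC -exprz_exp -[(-1) ^ 2%:Z]/((-1) ^+ 2) sqrrN expr1n exp1rz.
Qed.

Lemma even_mu b : B b -> (2 %| 0 - b.2)%Z.
Proof. by move=> [/(gapping_even gG)]; rewrite sub0r rpredN. Qed.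

(** The degree -mu(b) is even, so the sign of a value of [c] is the product of the signs of its
    arguments. *)
Lemma parity_c' t b w : sg (c' t b w) = c' t b (map sg w).
Proof.
elim/(word_ind gC): w => [d x hx|s1 s2 u w IHu IHw]; last first.
  rewrite map_cat /= (linearDP (multilin_c' t b _ _)).
  rewrite (linearDP (linear_parity gC)) IHu IHw (linearDP (linear_parity gC)).
  by rewrite (linearDP (multilin_c' t b _ _)) !map_cat.
have [Bb|nBb] := pselect (B b); last first.
  by rewrite /truncation asboolF// (linear0P (linear_parity gC)).
rewrite (parityE gC (degree_c' t b hx)) addrK even_sign; last exact: even_mu.
have sgE j v : C j v -> sg v = (-1) ^ (1 * (j - 1)) *: v.
  by rewrite mul1r; apply: parityE.
have := multilin_signs sgE [::] (multilin_c' t b) hx.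
by rewrite !cats0 mul1r => ->.
Qed.

(** Both labels of a splitting of [b] lie below [E] when [b] does, so truncation changes no term. *)
Lemma insertions_truncation eps sg' (f g : R -> operations V) t b d x :
  (forall j v, C j v -> sg' v = (-1) ^ (eps * (j - 1)) *: v) ->
  (forall t b, multilin (truncation f t b)) -> t \in `[0, 1] -> B b ->
  homogeneous C d x ->
  insertions G eps (f t) (g t) b d x =
  ins G sg' (truncation f t) (truncation g t) b x.
Proof.
move=> sgE fl t01 Bb hx; rewrite -(insertions_ins rG sgE _ _ (fl t) hx).
apply: eq_bigr => k _; apply: eq_bigr => i _; apply: eq_fsbigr => -[b1 b2].
rewrite inE => -[/= g1 g2 bE]; rewrite -bE in Bb.
have B1 : B b1 := below_lower g1 g2 Bb.
have B2 : B b2 by apply: (below_lower g2 g1); rewrite addrC.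
by rewrite !truncationE.
Qed.

Lemma parity_signed j v : C j v -> sg v = (-1) ^ (1 * (j - 1)) *: v.
Proof. by rewrite mul1r; apply: parityE. Qed.

Lemma id_unsigned j v : C j v -> id v = (-1) ^ (0 * (j - 1)) *: v.
Proof. by rewrite mul0r expr0z scale1r. Qed.

(** The differential equation is given on homogeneous words; both sides are multilinear, which
    extends it to all words. *)
Lemma derivative_m' t b x : t \in `[0, 1] -> B b ->
  has_derivative t (fun s => m' s b x)
    (ins G id (m' t) (c' t) b x - ins G sg (c' t) (m' t) b x).
Proof.
move=> t01 Bb; elim/(word_ind gC): x => [d x hx|s1 s2 u w du dw]; last first.
  have := has_derivativeD du dw; apply: eq_has_derivative => [s _|].
    by rewrite (linearDP (multilin_m' s b _ _)).
  have mlm := multilin_ins G b (@linear_id _ _) (multilin_m' t) (multilin_c' t).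
  have mlc := multilin_ins G b (linear_parity gC) (multilin_c' t) (multilin_m' t).
  rewrite (linearDP (mlm _ _)) (linearDP (mlc _ _)).
  by rewrite opprD addrACA.
have [v /curve_has_derivative dv vE] := iso_derivative iso t01 Bb hx.
apply: eq_has_derivative dv => [s s01|]; first by rewrite truncationE.
rewrite -(@insertions_truncation 1 sg c m t b d x parity_signed multilin_c' t01 Bb hx).
rewrite -(@insertions_truncation 0 id m c t b d x id_unsigned multilin_m' t01 Bb hx).
by move/eqP: vE; rewrite -addrA addr_eq0 opprB => /eqP.
Qed.

(** Up to the even mu(b), the sign from exchanging [x0] with the value of [c] cancels the cyclic
    sign. The minus is the summand 1 in the exponent of the symmetry of the pairing. *)
Lemma cyclic_c' t b x0 r : pair (c' t b (belast x0 r)) (last x0 r) =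
  - pair x0 (c' t b r).
Proof.
have gP := ainf_pairing (iso_ainf iso (clamp01 0)).
have pl v : linear ((pair^~ v) : V -> R^o) := pair_linearl gP v.
have pr u : linear (pair u : V -> R^o) := pair_linearr gP u.
have [Bb|nBb] := pselect (B b); last first.
  by rewrite /truncation asboolF// (linear0P (pl _)) (linear0P (pr _)) oppr0.
have cl := multilin_c' t b.
elim/(vector_ind gC): x0 => [d0 x0 Cx0|u w IHu IHw]; last first.
  rewrite [in RHS](linearDP (pl _)) opprD -IHu -IHw.
  case: r {IHu IHw} => [|r0 r] /=; first exact: (linearDP (pr _)).
  by rewrite (linearDP (cl [::] _)) (linearDP (pl _)).
elim/(word_ind gC): r => [d r hr|s1 s2 u w IHu IHw]; last first.
  rewrite [in RHS](linearDP (cl _ _)) (linearDP (pr _)) opprD -IHu -IHw.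
  rewrite !belast_cat !last_cat /=.
  (* For empty [s2] the letter is the last one and stands in the pairing; otherwise it is an
     argument of [c]. *)
  case: s2 {IHu IHw} => [|v s2] /=; first exact: (linearDP (pr _)).
  rewrite -!(cat_rcons (last x0 s1)).
  by rewrite (linearDP (cl _ _)) (linearDP (pl _)).
have Cr := degree_c' t b hr.
rewrite (pair_sign gP Cx0 Cr) addrK.
have := iso_cyclic iso (clamp01 t) Bb Cx0 hr.
have cE x : c (clamp t) b x = c' t b x by rewrite /truncation asboolT.
rewrite !cE => ->; set e := (d0 - 1) * sdeg d.
rewrite mulrDr -/e addrA even_sign; last by rewrite dvdz_mull// even_mu.
rewrite mulrA -exprzDr ?unitrN1// -addrA even_sign ?mulN1r ?opprK//.
by apply/dvdzP; exists e; rewrite mulr_natr.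
Qed.

Hypothesis B0 : B 0.

(** The basis of [V] is taken from the expansion of a smooth curve, here that of the operation with
    label 0 at the empty word; hence the condition [B0]. *)
Lemma enough_functionals_isotopy : enough_functionals V.
Proof.
have [s [a [[[D basisD _] _ _] _]]] := iso_smooth_m iso [::] B0.
exact: enough_functionals_basis basisD.
Qed.

Local Notation sepV := enough_functionals_isotopy.
Local Notation phi := (flow G rank c').

(** The base point [sigma] belongs to the target and the time [tau] to the source, whence the order
    of the arguments in [phi 1 0]. *)
Lemma Ainfty_hom_flow sigma tau : sigma \in `[0, 1] -> tau \in `[0, 1] ->
  Ainfty_hom C G E (m tau) (m sigma) (phi sigma tau).
Proof.
move=> s01 t01.
have fl b : multilin (phi sigma tau b).
  exact: (multilin_flow G rank multilin_c' continuous_c' sepV s01).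
split.
- split=> [b _ | b _]; first exact: fl.
  apply: (degree_flow rG multilin_c' c'0 continuous_c' sepV _ _
    (linear_component gC) (componentP gC) degree_c') => //.
    exact: (grading0 gC).
  by move=> j u v Cu Cv; rewrite -[u]scale1r; apply: (gradingP gC).
- by rewrite (flow0 rG multilin_c' c'0 continuous_c' sepV).
move=> b d x Bb hx.
transitivity (ins G sg (phi sigma tau) (m' tau) b x).
  have BG : B `<=` G by move=> ? [].
  rewrite (flow_homomorphism rG multilin_c' c'0 continuous_c' sepV BG below_lower
    (linear_parity gC) parity_c' multilin_m' derivative_m')//.
  apply: eq_fsbigr => -[b0 s]; rewrite inE => -[/= g0 gs bE _].
  rewrite truncationE//; apply: (below_lower g0 (b2 := \sum_(q <- s) q.2)).
    rewrite -[X in G X]add0r; apply: (G_sum rG) => //; exact: (ranked0 rG).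
  by rewrite bE.
rewrite -(insertions_ins rG parity_signed _ _ fl hx).
apply: eq_bigr => k _; apply: eq_bigr => i _; apply: eq_fsbigr => -[b1 b2].
rewrite inE => -[/= g1 g2 bE]; rewrite truncationE//.
by apply: (below_lower g2 g1); rewrite addrC bE.
Qed.

Lemma cyclic_hom_flow sigma tau : sigma \in `[0, 1] -> tau \in `[0, 1] ->
  cyclic_hom pair G E (phi sigma tau).
Proof.
move=> s01 t01; have gP := ainf_pairing (iso_ainf iso (clamp01 0)).
split=> [x y|b x [gb _] xb].
  by rewrite !(flow0 rG multilin_c' c'0 continuous_c' sepV)//= eqxx.
have := pairing_flow rG multilin_c' c'0 continuous_c' sepV
  (P := pair) (pair_linearl gP) (pair_linearr gP) cyclic_c' x s01 t01 gb.
have -> : (if b == 0 then pair_word pair x else 0) = 0.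
  by case: (b =P 0) xb => [->|//]; case: x => [|u [|v [|? ?]]] //; rewrite eqxx.
move=> H; rewrite -[RHS]H /pairing_sum bsum_cutsum cutsumE; apply: eq_bigr => k _.
exact: (fsum_splittings rG b (fun b1 b2 => pair (phi sigma tau b1 (take k x))
  (phi sigma tau b2 (drop k x)))).
Qed.

Lemma has_inverse_flow : has_inverse C G E (m 0) (m 1) (phi 1 0).
Proof.
have [z01 o01] : (0 : R) \in `[0, 1] /\ (1 : R) \in `[0, 1].
  by rewrite !in_itv /= !lexx ler01.
exists (phi 0 1); split; first exact: Ainfty_hom_flow.
- move=> b x [gb _]; rewrite (compose_flow rG multilin_c' c'0 continuous_c' sepV)//.
  by rewrite (flow_tau G rank multilin_c' continuous_c' sepV).
- move=> b x [gb _]; rewrite (compose_flow rG multilin_c' c'0 continuous_c' sepV)//.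
  by rewrite (flow_tau G rank multilin_c' continuous_c' sepV).
Qed.

Lemma unital_hom_flow e sigma tau : sigma \in `[0, 1] -> tau \in `[0, 1] ->
  unital_isotopy C G E e m c -> unital_hom G E e (phi sigma tau).
Proof.
move=> s01 t01 ue.
have ce t b s1 s2 : t \in `[0, 1] -> c' t b (s1 ++ e :: s2) = 0.
  move=> t01'; rewrite /truncation; case: asboolP => // Bb.
  exact: (unital_iso_c ue s1 s2 (clamp01 t) Bb).
have fe b s1 s2 := flow_unital rG multilin_c' c'0 continuous_c' sepV b s1 s2 ce s01 t01.
split=> [|b _ b0|b s1 s2 _ sz].
- by rewrite (fe 0 [::] [::]) /= eqxx.
- by rewrite (fe b [::] [::]) /= (negbTE b0).
- by rewrite fe; case: s1 sz => [|? [|? ?]] //=; case: s2.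
Qed.

End Isotopy.

(* The case E <= 0, in which the hypotheses do not even provide a basis of V. *)
Lemma identity_spec (R : realType) (V : lmodType R) (C : int -> set V)
    (pair : V -> V -> R) (G : set (R * int)) (E : \bar R)
    (m m' : operations V) (e : V) : (forall b, ~ below G E b) ->
  [/\ Ainfty_hom C G E m m' (@identity R V),
      cyclic_hom pair G E (@identity R V),
      unital_hom G E e (@identity R V) &
      has_inverse C G E m m' (@identity R V)].
Proof.
move=> nB.
have hom m1 m2 : Ainfty_hom C G E m1 m2 (@identity R V).
  by split=> [|//|b d x /nB//]; split=> b /nB.
split=> //.
- by split=> [x y|b x /nB//]; rewrite /= eqxx.
- by split=> [|b /nB//|b s1 s2 /nB//]; rewrite /= eqxx.
- by exists (@identity R V); split=> // b x /nB.
Qed.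

(* E = +oo is the statement without truncation, E finite the one modulo T^E. *)
Theorem theorem8p2 (R : realType) (V : lmodType R) (C : int -> set V)
    (n : int) (pair : V -> V -> R) (G : set (R * int)) (E : \bar R)
    (m c : R -> operations V) :
  gapping_monoid G -> grading C -> pseudo_isotopy C n pair G E m c ->
  (exists f : operations V,
     [/\ Ainfty_hom C G E (m 0) (m 1) f, cyclic_hom pair G E f
       & has_inverse C G E (m 0) (m 1) f]) /\
  (forall e : V, unital_isotopy C G E e m c ->
   exists f : operations V,
     [/\ Ainfty_hom C G E (m 0) (m 1) f, cyclic_hom pair G E f,
         unital_hom G E e f & has_inverse C G E (m 0) (m 1) f]).
Proof.
move=> gG gC iso; have [rank rG] := gapping_ranked gG.
have [z01 o01] : (0 : R) \in `[0, 1] /\ (1 : R) \in `[0, 1].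
  by rewrite !in_itv /= !lexx ler01.
(* Energies are nonnegative, so if 0 is not below [E] then nothing is. *)
have [B0|nB0] := pselect (below G E 0).
  have hom := Ainfty_hom_flow gG gC iso rG B0 o01 z01.
  have cyc := cyclic_hom_flow gG gC iso rG B0 o01 z01.
  have inv := has_inverse_flow gG gC iso rG B0.
  split=> [|e ue]; exists (flow G rank (truncation G E c) 1 0); split=> //.
  exact: (unital_hom_flow iso rG B0 o01 z01 ue).
have nB b : ~ below G E b.
  move=> [gb bE]; apply: nB0; split; first exact: (gapping0 gG).
  by apply: le_lt_trans bE; rewrite lee_fin; apply: (gapping_energy gG).
have H e := @identity_spec R V C pair G E (m 0) (m 1) e nB.
split=> [|e _]; exists (@identity R V); last exact: H.
(* The vector 0 only fills the place of the unit, whose conclusion is discarded. *)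
by have [? ? _ ?] := H 0.
Qed.
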